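(* Let $0<\alpha<2$, $c>0$, and let $(X_n)_{n\ge 1}$ be a determining sequence of real random variables on a probability space $(\Omega,\mathcal F,P)$ with limit random measure $\mu$. Assume that $\mu\in S(\alpha,c)$ with probability $1$. Then there exists a subsequence $(X_{n_k})_{k\ge1}$ (with $n_1<n_2<\cdots$) such that for every real sequence $(a_k)_{k\ge 1}$ satisfying $$\max_{1\le k\le N}|a_k| = o(A_N)\quad\text{as } N\to\infty,\qquad A_N=\Big(\sum_{k=1}^N |a_k|^\alpha\Big)^{1/\alpha},$$ we have $$A_N^{-1}\sum_{k=1}^N a_kX_{n_k}\overset{d}{\longrightarrow} G_{\alpha,c}\qquad\text{as } N\to\infty .$$ (The subsequence $(n_k)$ does not depend on the sequence $(a_k)$.)
   Context: Here $\overset{d}{\longrightarrow}$ denotes convergence in distribution. For $c>0$ and $0<\alpha<2$, $G_{\alpha,c}$ denotes the distribution function with characteristic function $\exp(-c|t|^\alpha)$, and $S(\alpha,c)$ denotes the class of symmetric probability distributions on $\mathbb R$ whose characteristic function $\varphi$ satisfies $\varphi(t)=1-c|t|^\alpha+o(|t|^\alpha)$ as $t\to0$. A sequence $(X_n)$ of random variables on $(\Omega,\mathcal F,P)$ is called determining if for every event $A\in\mathcal F$ with $P(A)>0$ there exists a distribution function $F_A$ (of a probability measure on $\mathbb R$) such that $\lim_{n\to\infty}P(X_n<t\mid A)=F_A(t)$ for all continuity points $t$ of $F_A$. Limit random measure: a sequence $(\xi_n)$ of bounded random variables converges weakly in $L^\infty$ to a bounded random variable $\xi$ if $E(\xi_n\eta)\to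 E(\xi\eta)$ for every integrable random variable $\eta$. If $(X_n)$ is determining, then for every continuity point $t$ of $F_\Omega$ the indicators $I\{X_n\le t\}$ converge weakly in $L^\infty$ to some random variable $G_t$, with $G_s\le G_t$ a.s. for $s\le t$. Choosing a countable dense set $D$ of continuity points of $F_\Omega$, one can choose versions of $G_t$, $t\in D$, such that for each fixed $\omega\in\Omega$ the function $t\mapsto G_t(\omega)$, $t\in D$, extends to a distribution function on $\mathbb R$. The corresponding probability measure $\mu=\mu(\omega)$ is called the limit random measure of $(X_n)$. It is a measurable map from $(\Omega,\mathcal F,P)$ to the space of probability measures on $\mathbb R$ equipped with the Prohorov metric (and its Borel $\sigma$-field). The condition $\mu\in S(\alpha,c)$ with probability $1$ means that $\mu(\omega)\in S(\alpha,c)$ for almost every $\omega$. The condition $\max_{1\le k\le N}|a_k|=o(A_N)$ means that $A_N>0$ for all large $N$ and $\max_{1\le k\le N}|a_k|/A_N\to0$ as $N\to\infty$. *)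

(* Defs.v *)
From HB Require Import structures.
From mathcomp Require Import all_boot all_order all_algebra.
From mathcomp Require Import all_classical all_reals all_analysis.
From mathcomp Require Export complex.

Set Implicit Arguments.
Unset Strict Implicit.
Unset Printing Implicit Defensive.

Import Order.TTheory GRing.Theory Num.Theory.
Import numFieldNormedType.Exports.

Local Open Scope classical_set_scope.
Local Open Scope ring_scope.

Section laws_on_the_line.
Variable R : realType.
Implicit Type nu : probability R R.

Definition dfun nu (t : R) : R := fine (nu `]-oo, t]%classic).

Definition continuity_pt nu (t : R) : Prop := {for t, continuous (dfun nu)}.

(* \int e^(itx) nu(dx), by real and imaginary parts: the integral is real-valued. *)
Definition charfun nu (t : R) : R[i] :=
  ((\int[nu]_x cos (t * x)) +i* (\int[nu]_x sin (t * x)))%C.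

Definition symmetric_law nu : Prop :=
  forall B : set R, measurable B -> nu (-%R @^-1` B) = nu B.

(* The law with distribution function G_{alpha,c}; it is determined by this. *)
Definition stable_law (alpha c : R) nu : Prop :=
  forall t : R, charfun nu t = ((expR (- (c * `|t| `^ alpha)))%:C)%C.

Definition class_S (alpha c : R) nu : Prop :=
  symmetric_law nu /\
  Normc.normc (charfun nu t - ((1 - c * `|t| `^ alpha)%:C)%C) / `|t| `^ alpha
    @[t --> (0 : R)^'] --> (0 : R).

End laws_on_the_line.

Section limit_random_measure.
Context d (T : measurableType d) (R : realType) (P : probability T R).
Implicit Type X : nat -> {RV P >-> R}.

Definition cond_prob (B A : set T) : R := fine (P (B `&` A)) / fine (P A).

Definition cond_limit_law X (A : set T) (nu : probability R R) : Prop :=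
  forall t : R, continuity_pt nu t ->
    cond_prob [set w | X n w < t] A @[n --> \oo] --> dfun nu t.

Definition determining X : Prop :=
  forall A : set T, measurable A -> (0 < P A)%E ->
    exists nu : probability R R, cond_limit_law X A nu.

Definition weak_Linfty_cvg (xi : nat -> T -> R) (xi0 : T -> R) : Prop :=
  forall eta : T -> R, P.-integrable [set: T] (EFin \o eta) ->
    ('E_P[(xi n \* eta)%R])%E @[n --> \oo] --> ('E_P[(xi0 \* eta)%R])%E.

(* The weak limit G_t is w |-> dfun (mu w) t, the values at t in D of the
   distribution function of mu w. Measurability of mu is for the sigma-field
   generated by the evaluations nu |-> nu B; on probability measures on the line
   it is the Borel sigma-field of the Prohorov metric. *)
Definition is_limit_random_measure X (mu : {RV P >-> pprobability R R}) : Prop :=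
  exists (nu : probability R R) (D : set R),
    [/\ cond_limit_law X [set: T] nu, countable D, dense D,
        D `<=` continuity_pt nu &
        forall t, D t ->
          weak_Linfty_cvg (fun n => \1_[set w | X n w <= t])
                          (fun w => dfun (mu w) t)].

Definition cvg_in_distribution (Y : nat -> T -> R) (nu : probability R R) : Prop :=
  forall t : R, continuity_pt nu t ->
    fine (P [set w | Y N w <= t]) @[N --> \oo] --> dfun nu t.

End limit_random_measure.

Section coefficients.
Variable R : realType.
Implicit Type a : nat -> R.

(* Sequences are indexed from 0: the first N terms are a 0, ..., a (N - 1). *)
Definition alpha_norm (alpha : R) a (N : nat) : R :=
  (\sum_(k < N) `|a k| `^ alpha) `^ alpha^-1.

Definition max_abs a (N : nat) : R := \big[Num.max/0]_(k < N) `|a k|.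

Definition asympt_negligible (alpha : R) a : Prop :=
  (\forall N \near \oo, 0 < alpha_norm alpha a N) /\
  max_abs a N / alpha_norm alpha a N @[N --> \oo] --> (0 : R).

End coefficients.

(* Main.v *)
Require Import Defs.
From mathcomp Require Import all_boot all_order all_algebra.
From mathcomp Require Import all_classical all_reals all_analysis.
From mathcomp Require Import measurable_realfun ring lra.
Import Order.TTheory GRing.Theory Num.Theory.
Import numFieldNormedType.Exports.

Set Implicit Arguments.
Unset Strict Implicit.
Unset Printing Implicit Defensive.

Local Open Scope classical_set_scope.
Local Open Scope ring_scope.

(** Write phi(t) for the characteristic function of the random law mu; its real
    part is 1 - c |t|^alpha + o(|t|^alpha) and its imaginary part o(|t|^alpha),
    almost surely. Put psi(t) = exp(- c |t|^alpha) and s_k = t a_k / A_N. By the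
    hypotheses on the coefficients the s_k tend to 0 uniformly as N grows and
    the sum of the |s_k|^alpha is |t|^alpha, so the product of the psi(s_k) is
    exactly psi(t). The theorem says that this product is the limit of the mean
    of the product of the e^(i s_k X_(n_k)).

    The two are compared by telescoping, one factor at a time. The past factors
    form a bounded random variable eta, and the step costs
    E eta (e^(i s X_(n_k)) - phi(s)) + E eta (phi(s) - psi(s)) with s = s_k; the
    factors psi that stand for the future are deterministic numbers of modulus
    at most 1.

    The first term is small by the choice of n_k. Weak convergence of the
    indicators extends to weak convergence of bounded Lipschitz functions
    (weak_cvg_Lipschitz), and this is uniform when the coefficients of the past
    and of the present variable range over [-1, 1] (uniform_mixing). Hence n_k
    can be chosen, without reference to the weights, so that the k-th term is at
    most 2^-k (exists_mixing_subsequence). The sum of these terms from K on is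
    small, and the terms before K do not matter because each fixed coefficient
    tends to 0.

    The second term is o(|s|^alpha) for each point of the sample space, but not
    uniformly. So eta also contains the indicator of an event A of probability
    close to 1 on which the expansion of phi is uniform (uniform_expansion);
    summing e |s_k|^alpha over k gives e |t|^alpha. Only countably many events
    are needed, and the k-th index takes care of the first k + 1 of them.

    It remains to pass from characteristic functions to distributions
    (levy_continuity). The test functions f for which E f(Y_N) converges to the
    integral of f under G include all the cosines, hence the Cauchy kernels
    s / (s^2 + (y - x)^2), which are Laplace transforms of cosines, hence the
    differences of arc tangents; these approximate the indicators of half-lines.
    All the computations are done with sines and cosines in place of complex
    exponentials. *)

(** * Bounded measurable functions and their integrals *)

Section bounded_measurable.
Context d (T : measurableType d) (R : realType).
Implicit Types f g : T -> R.

Definition bounded_measurable f : Prop :=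
  measurable_fun [set: T] f /\ exists M : R, forall x, `|f x| <= M.

Lemma bm_cst (k : R) : bounded_measurable (fun=> k).
Proof. by split; [exact: measurable_cst | exists `|k|]. Qed.

Lemma bmD f g : bounded_measurable f -> bounded_measurable g ->
  bounded_measurable (fun x => f x + g x).
Proof.
move=> [mf [M fM]] [mg [K gK]]; split; first exact: measurable_funD.
by exists (M + K) => x; rewrite (le_trans (ler_normD _ _))// lerD.
Qed.

Lemma bmM f g : bounded_measurable f -> bounded_measurable g ->
  bounded_measurable (fun x => f x * g x).
Proof.
move=> [mf [M fM]] [mg [K gK]]; split; first exact: measurable_funM.
by exists (M * K) => x; rewrite normrM ler_pM.
Qed.

Lemma bmB f g : bounded_measurable f -> bounded_measurable g ->
  bounded_measurable (fun x => f x - g x).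
Proof.
move=> [mf [M fM]] [mg [K gK]]; split; first exact: measurable_funB.
by exists (M + K) => x; rewrite (le_trans (ler_normB _ _))// lerD.
Qed.

Lemma bm_norm f : bounded_measurable f -> bounded_measurable (fun x => `|f x|).
Proof.
move=> [mf [M fM]]; split; first exact: measurableT_comp.
by exists M => x; rewrite normr_id.
Qed.

Lemma bm_indic (A : set T) : measurable A -> bounded_measurable (\1_A : T -> R).
Proof.
move=> mA; split; first exact: measurable_indic.
by exists 1 => x; rewrite indicE; case: (_ \in _); rewrite ?normr1 ?normr0.
Qed.

Variable P : probability T R.

Lemma bm_integrable f : bounded_measurable f ->
  P.-integrable [set: T] (EFin \o f).
Proof.
move=> [mf [M fM]]; apply: measurable_bounded_integrable => //.
  by rewrite ltey_eq fin_num_measure.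
exists M; split; first exact: num_real.
by move=> x Mx y _; apply: le_trans (fM y) (ltW Mx).
Qed.

Lemma bm_RintegralD f g : bounded_measurable f -> bounded_measurable g ->
  \int[P]_x (f x + g x) = \int[P]_x f x + \int[P]_x g x.
Proof. by move=> bf bg; apply: RintegralD => //; exact: bm_integrable. Qed.

Lemma bm_RintegralB f g : bounded_measurable f -> bounded_measurable g ->
  \int[P]_x (f x - g x) = \int[P]_x f x - \int[P]_x g x.
Proof. by move=> bf bg; apply: RintegralB => //; exact: bm_integrable. Qed.

Lemma bm_RintegralZ k f : bounded_measurable f ->
  \int[P]_x (k * f x) = k * \int[P]_x f x.
Proof. by move=> bf; apply: RintegralZl => //; exact: bm_integrable. Qed.

Lemma bm_le_Rintegral f g : bounded_measurable f -> bounded_measurable g ->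
  (forall x, f x <= g x) -> \int[P]_x f x <= \int[P]_x g x.
Proof. by move=> bf bg fg; apply: le_Rintegral => //; exact: bm_integrable. Qed.

Lemma prob_Rintegral_cst k : \int[P]_x k = k.
Proof. by rewrite Rintegral_cst// [X in fine X]probability_setT mulr1. Qed.

Lemma bm_norm_Rintegral f g : bounded_measurable f -> bounded_measurable g ->
  (forall x, `|f x| <= g x) -> `|\int[P]_x f x| <= \int[P]_x g x.
Proof.
move=> bf bg fg; apply: le_trans (le_normr_Rintegral _ (bm_integrable bf)) _ => //.
by apply: bm_le_Rintegral => //; exact: bm_norm.
Qed.

Lemma bm_norm_Rintegral_cst f M : bounded_measurable f ->
  (forall x, `|f x| <= M) -> `|\int[P]_x f x| <= M.
Proof.
move=> bf fM; rewrite -[leRHS]prob_Rintegral_cst.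
exact: bm_norm_Rintegral (bm_cst M) fM.
Qed.

Lemma prob_Rintegral_indic (A : set T) : measurable A ->
  \int[P]_x \1_A x = fine (P A).
Proof. by move=> mA; rewrite /Rintegral integral_indic// setIT. Qed.

(** A constant dominates the sequence, and it is integrable because P is
    finite. *)
Lemma bounded_cvg_Rintegral (f_ : nat -> T -> R) f (M : R) :
  (forall n, measurable_fun [set: T] (f_ n)) ->
  (forall n x, `|f_ n x| <= M) ->
  (forall x, f_ ^~ x @ \oo --> f x) ->
  \int[P]_x f_ n x @[n --> \oo] --> \int[P]_x f x.
Proof.
move=> mf fM ff.
have mfl : measurable_fun [set: T] f.
  by apply: (measurable_fun_cvg mf) => x _; exact: ff.
have [|||||/= h1 _ h2] := @dominated_convergence _ _ _ P setT measurableT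
    (fun n => EFin \o f_ n) (EFin \o f) (cst M%:E).
- by move=> n; exact/measurable_EFinP.
- exact/measurable_EFinP.
- by apply: aeW => x _; apply: cvg_EFin; [exact: nearW|exact: ff].
- exact: bm_integrable (bm_cst M).
- by apply: aeW => x n _; rewrite /= lee_fin.
- apply: fine_cvg; rewrite fineK; first exact: h2.
  exact: integrable_fin_num h1.
Qed.

End bounded_measurable.
Arguments bm_cst {d T R} k.

Lemma bm_comp d (T : measurableType d) d' (T' : measurableType d')
    (R : realType) (f : T' -> R) (X : T -> T') :
  bounded_measurable f -> measurable_fun [set: T] X ->
  bounded_measurable (fun w => f (X w)).
Proof.
move=> [mf [M fM]] mX; split; first exact: measurableT_comp.
by exists M => x.
Qed.

(** * Convergence of positive functionals *)

Section positive_functionals.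
Variable R : realType.
Implicit Types (f g w : R -> R) (L : (R -> R) -> R).

(** Both means E f(Y) and weighted means E (eta f(X)) against a random law are
    functionals of the test function f; linearity and monotonicity are all that
    the two limit theorems below use. *)
Definition positive_functional L : Prop :=
  [/\ forall f g, bounded_measurable f -> bounded_measurable g ->
        L (fun x => f x + g x) = L f + L g,
      forall k f, bounded_measurable f -> L (fun x => k * f x) = k * L f &
      forall f g, bounded_measurable f -> bounded_measurable g ->
        (forall x, f x <= g x) -> L f <= L g].

Lemma functionalB L f g : positive_functional L ->
  bounded_measurable f -> bounded_measurable g ->
  L (fun x => f x - g x) = L f - L g.
Proof.
move=> [LD LZ _] bf bg.
rewrite -mulN1r -LZ// -LD//; last by apply: bmM => //; exact: bm_cst.
by congr L; apply/funext => x; rewrite mulN1r.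
Qed.

Lemma functional_dist L f g w : positive_functional L ->
  bounded_measurable f -> bounded_measurable g -> bounded_measurable w ->
  (forall x, `|f x - g x| <= w x) -> `|L f - L g| <= L w.
Proof.
move=> pL bf bg bw fgw; case: (pL) => _ LZ Lle.
have bN : bounded_measurable (fun x => -1 * w x).
  by apply: bmM => //; exact: bm_cst.
rewrite -functionalB// ler_norml -mulN1r -LZ// !Lle//; try exact: bmB.
- by move=> x; have := fgw x; rewrite ler_norml => /andP[].
- by move=> x; have := fgw x; rewrite ler_norml mulN1r => /andP[].
Qed.

Variables (L_ : nat -> (R -> R) -> R) (L : (R -> R) -> R).
Hypothesis pL_ : forall n, positive_functional (L_ n).
Hypothesis pL : positive_functional L.

Definition convergent_on f : Prop :=
  bounded_measurable f /\ L_ n f @[n --> \oo] --> L f.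

Lemma convergent_onD f g : convergent_on f -> convergent_on g ->
  convergent_on (fun x => f x + g x).
Proof.
move=> [bf cf] [bg cg]; split; first exact: bmD.
have [LD _ _] := pL; rewrite LD//.
under eq_fun => n do (have [/(_ f g bf bg) -> _ _] := pL_ n).
exact: cvgD.
Qed.

Lemma convergent_onZ k f : convergent_on f -> convergent_on (fun x => k * f x).
Proof.
move=> [bf cf]; split; first by apply: bmM => //; exact: bm_cst.
have [_ LZ _] := pL; rewrite LZ//.
under eq_fun => n do (have [_ /(_ k f bf) -> _] := pL_ n).
exact: cvgMr.
Qed.

Lemma convergent_onB f g : convergent_on f -> convergent_on g ->
  convergent_on (fun x => f x - g x).
Proof.
move=> cf /(convergent_onZ (-1)) /(convergent_onD cf).
by congr convergent_on; apply/funext => x; rewrite mulN1r.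
Qed.

(** Positivity turns a pointwise bound |f - g| <= w into a bound by L w on the
    error made when f is replaced by g. Because w is itself a test function, the
    error bound also holds in the limit for the functionals L_ n, and this takes
    the place of a tightness argument. *)
Lemma convergent_on_sandwich f : bounded_measurable f ->
  (forall e, 0 < e -> exists g w, [/\ convergent_on g, convergent_on w,
     forall x, `|f x - g x| <= w x & L w <= e]) ->
  convergent_on f.
Proof.
move=> bf apx; split=> //; apply/cvgrPdist_le => e e0.
have e4 : 0 < e / 4 by rewrite divr_gt0.
have [g [w [[bg cg] [bw cw] fgw Lwe]]] := apx _ e4.
move/cvgrPdist_le : cg => /(_ _ e4) cg.
move/cvgrPdist_le : cw => /(_ _ e4) cw.
near=> n.
have h1 := functional_dist pL bf bg bw fgw.
have h2 := functional_dist (pL_ n) bf bg bw fgw.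
have h3 : `|L g - L_ n g| <= e / 4 by near: n.
have h4 : `|L w - L_ n w| <= e / 4 by near: n.
move: h1 h2 h3 h4; rewrite !ler_norml.
move=> /andP[h1 h1'] /andP[h2 h2'] /andP[h3 h3'] /andP[h4 h4'].
by apply/andP; split; lra.
Unshelve. all: by end_near. Qed.

End positive_functionals.

Section integral_functionals.
Context d (T : measurableType d) (R : realType) (P : probability T R).

Lemma positive_integral_comp (Y : T -> R) : measurable_fun [set: T] Y ->
  positive_functional (fun f => \int[P]_w f (Y w)).
Proof.
move=> mY; split=> [f g bf bg|k f bf|f g bf bg fg].
- by apply: bm_RintegralD; exact: bm_comp.
- by apply: bm_RintegralZ; exact: bm_comp.
- by apply: bm_le_Rintegral => //; exact: bm_comp.
Qed.

Lemma positive_weighted_integral_comp (eta Y : T -> R) :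
  bounded_measurable eta -> (forall w, 0 <= eta w) ->
  measurable_fun [set: T] Y ->
  positive_functional (fun f => \int[P]_w (eta w * f (Y w))).
Proof.
move=> beta eta0 mY; split=> [f g bf bg|k f bf|f g bf bg fg].
- rewrite -bm_RintegralD; [|by apply: bmM => //; exact: bm_comp..].
  by apply: eq_Rintegral => w _; rewrite mulrDr.
- rewrite -bm_RintegralZ; last by apply: bmM => //; exact: bm_comp.
  by apply: eq_Rintegral => w _; rewrite mulrCA.
- apply: bm_le_Rintegral => [||w]; [by apply: bmM => //; exact: bm_comp..|].
  exact: ler_wpM2l.
Qed.

Variable mu : {RV P >-> pprobability R R}.

(** A random law is a kernel, so measurability in w is known for nonnegative f;
    the general case follows by adding the bound of f. *)
Lemma bm_mixture f : bounded_measurable f ->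
  bounded_measurable (fun w => \int[mu w]_x f x).
Proof.
move=> bf; case: (bf) => mf [M fM]; split; last first.
  by exists M => w; exact: bm_norm_Rintegral_cst.
have -> : (fun w => \int[mu w]_x f x) =
    (fun w => \int[mu w]_x (f x + M) - M).
  apply/funext => w; rewrite bm_RintegralD//; last exact: bm_cst.
  by rewrite prob_Rintegral_cst addrK.
apply: measurable_funB; last exact: measurable_cst.
apply: (@measurableT_comp _ _ _ _ _ _ (@fine R)) => //.
apply: (@measurable_fun_integral_kernel _ _ T R R (fun w => mu w)) => //.
- move=> U mU.
  have mmu : measurable_fun [set: T] (mu : T -> pprobability R R).
    exact: measurable_funPT.
  exact: (@measurable_kernel _ _ _ _ _ (kprobability mmu)).
- by move=> x; rewrite lee_fin; have := fM x; rewrite ler_norml => /andP[]; lra.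
- by apply/measurable_EFinP/measurable_funD => //; exact: measurable_cst.
Qed.

Lemma positive_mixture (eta : T -> R) :
  bounded_measurable eta -> (forall w, 0 <= eta w) ->
  positive_functional (fun f => \int[P]_w (eta w * \int[mu w]_x f x)).
Proof.
move=> beta eta0; split=> [f g bf bg|k f bf|f g bf bg fg].
- rewrite -bm_RintegralD; [|by apply: bmM => //; exact: bm_mixture..].
  by apply: eq_Rintegral => w _; rewrite bm_RintegralD// mulrDr.
- rewrite -bm_RintegralZ; last by apply: bmM => //; exact: bm_mixture.
  by apply: eq_Rintegral => w _; rewrite bm_RintegralZ// mulrCA.
- apply: bm_le_Rintegral => [||w]; [by apply: bmM => //; exact: bm_mixture..|].
  by apply: ler_wpM2l => //; exact: bm_le_Rintegral.
Qed.

End integral_functionals.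

(** * From half-lines to Lipschitz test functions *)

Section lipschitz_test_functions.
Variable R : realType.
Implicit Types (f g w : R -> R).

Lemma dense_itvoo (D : set R) (x y : R) : dense D -> x < y ->
  exists2 t, D t & x < t < y.
Proof.
move=> dD xy; have [||t [/= txy Dt]] := dD `]x, y[%classic.
- by exists ((x + y) / 2) => /=; rewrite in_itv/=; apply/andP; split; lra.
- exact: interval_open.
- by exists t => //; move: txy; rewrite /= in_itv.
Qed.

Variables (L_ : nat -> (R -> R) -> R) (L : (R -> R) -> R).
Hypothesis pL_ : forall n, positive_functional (L_ n).
Hypothesis pL : positive_functional L.
Variable D : set R.
Hypothesis dD : dense D.
Hypothesis L1 : convergent_on L_ L (fun=> 1).
Hypothesis LD : forall t, D t -> convergent_on L_ L \1_`]-oo, t].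

(** Density allows each new node to be taken in D at a distance between h and
    2 h from the previous one, so m nodes cover a length m h and f varies by at
    most K (2 h) between two of them. *)
Lemma step_approximation f (K h a : R) (m : nat) :
  (forall x y, `|f x - f y| <= K * `|x - y|) -> 0 <= K -> 0 < h -> D a ->
  exists b g, [/\ D b, a + m%:R * h <= b, convergent_on L_ L g,
    forall x, a < x <= b -> `|f x - g x| <= K * (2 * h) &
    forall x, ~~ (a < x <= b) -> g x = 0].
Proof.
move=> fK K0 h0 Da; elim: m => [|m [b [g [Db ab cg fg g0]]]].
  exists a, (fun=> 0 * 1); split=> //.
  - by rewrite mul0r addr0.
  - exact: convergent_onZ.
  - by move=> x; rewrite lt_leAnge; case: (x <= a); rewrite ?andbF.
  - by move=> x _; rewrite mul0r.
have [|b' Db' /andP[bb' b'b]] := @dense_itvoo D (b + h) (b + 2 * h) dD.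
  by lra.
have ab0 : a <= b by rewrite (le_trans _ ab)// lerDl mulr_ge0// ltW.
exists b', (fun x => g x + f b' * (\1_`]-oo, b'] x - \1_`]-oo, b] x)); split=> //.
- by rewrite -natr1 mulrDl mul1r; lra.
- by apply: convergent_onD => //; apply: convergent_onZ => //;
    apply: convergent_onB => //; exact: LD.
- move=> x /andP[ax xb']; rewrite !indicE !mem_setE !in_itv/= xb'.
  have [xb|bx] := leP x b.
    by rewrite subrr mulr0 addr0; apply: fg; rewrite ax.
  rewrite g0; last by rewrite ax/= -ltNge.
  rewrite add0r subr0 mulr1 (le_trans (fK _ _))// ler_wpM2l//.
  by rewrite ler_norml; apply/andP; split; lra.
- move=> x /negP nx; rewrite g0; last first.
    by apply/negP => /andP[ax xb]; apply: nx; rewrite ax/=; lra.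
  rewrite !indicE !mem_setE !in_itv/= add0r.
  have [xa|ax] := leP x a.
    have -> : x <= b by lra.
    have -> : x <= b' by lra.
    by rewrite subrr mulr0.
  have [xb'|b'x] := leP x b'; first by exfalso; apply: nx; rewrite ax.
  rewrite (_ : x <= b = false) ?subrr ?mulr0//.
  by apply/negbTE; rewrite -ltNge; lra.
Qed.

(** The Helly-Bray theorem for positive functionals: inside ]a, b] the function f
    is close to a step function, and outside its bound B is charged to the
    complement of ]a, b], whose indicator is again a convergent test function. *)
Lemma convergent_on_Lipschitz f (K : R) :
  (forall e, 0 < e -> exists M, L (\1_(~` `]- M, M])) <= e) ->
  bounded_measurable f -> (forall x y, `|f x - f y| <= K * `|x - y|) ->
  convergent_on L_ L f.
Proof.
move=> tightL bf fK; apply: convergent_on_sandwich => // e e0.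
have [mf [B fB]] := bf; case: (pL) => LA LZ Lle.
have B0 : 0 <= B by rewrite (le_trans _ (fB 0)).
have K0 : 0 <= K.
  by have := le_trans (normr_ge0 _) (fK 1 0); rewrite subr0 normr1 mulr1.
have [bm1 _] := L1.
have L10 : 0 <= L (fun=> 1).
  rewrite -(mul0r (L (fun=> 1))) -LZ//; apply: Lle => [||x]; last by rewrite mul0r.
  - exact: (bmM (bm_cst 0) bm1).
  - exact: bm1.
have KL : 0 < K * L (fun=> 1) + 1 by rewrite ltr_pwDr// mulr_ge0.
pose h := e / (4 * (K * L (fun=> 1) + 1)).
have h0 : 0 < h by rewrite divr_gt0// mulr_gt0.
have B1 : 0 < B + 1 by rewrite ltr_pwDr.
have [|M LM] := tightL (e / (2 * (B + 1))); first by rewrite divr_gt0// mulr_gt0.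
have [|a Da /andP[aM1 aM]] := @dense_itvoo D (- M - 1) (- M) dD; first by lra.
(* enough steps of length h to go from a, which exceeds - M - 1, beyond M *)
pose m := Num.truncn (`|2 * M + 1| / h).
have hm : 2 * M + 1 <= m.+1%:R * h.
  rewrite -ler_pdivrMr//; apply: le_trans (ltW (truncnS_gt _)).
  by rewrite ler_pM2r ?invr_gt0// ler_norm.
have [b [g [Db ab cg fg g0]]] := step_approximation m.+1 fK K0 h0 Da.
have bM : M <= b by lra.
have le_ab : a <= b by rewrite (le_trans _ ab)// lerDl mulr_ge0// ltW.
have cab : convergent_on L_ L (fun x => 1 - (\1_`]-oo, b] x - \1_`]-oo, a] x)).
  by apply: convergent_onB => //; apply: convergent_onB => //; exact: LD.
have [bab _] := cab.
have Kh0 : 0 <= K * (2 * h) by rewrite mulr_ge0// mulr_ge0// ltW.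
exists g, (fun x => K * (2 * h) * 1 + B * (1 - (\1_`]-oo, b] x - \1_`]-oo, a] x))).
split=> //.
- by apply: convergent_onD => //; apply: convergent_onZ.
- move=> x; rewrite mulr1 !indicE !mem_setE !in_itv/=.
  have [xa|ax] := leP x a.
    rewrite g0 ?ltNge ?xa//.
    have -> : x <= b by lra.
    by rewrite !subr0 subrr subr0 mulr1 (le_trans (fB x))// lerDr.
  have [xb|bx] := leP x b.
    by rewrite subr0 subrr mulr0 addr0 fg// ax.
  rewrite g0; last by rewrite ax/= -ltNge.
  by rewrite !subr0 mulr1 (le_trans (fB x))// lerDr.
rewrite LA; last 2 first.
- by apply: bmM => //; exact: bm_cst.
- exact: bmM (bm_cst B) bab.
rewrite !LZ//.
have h1 : K * (2 * h) * L (fun=> 1) <= e / 2.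
  rewrite /h.
  have -> : K * (2 * (e / (4 * (K * L (fun=> 1) + 1)))) * L (fun=> 1) =
    e / 2 * (K * L (fun=> 1) / (K * L (fun=> 1) + 1)).
    by field; rewrite lt0r_neq0.
  rewrite ler_piMr//; first by rewrite divr_ge0// ltW.
  by rewrite ler_pdivrMr// mul1r lerDl.
have h2 : B * L (fun x => 1 - (\1_`]-oo, b] x - \1_`]-oo, a] x)) <= e / 2.
  apply: (@le_trans _ _ (B * (e / (2 * (B + 1))))).
    rewrite ler_wpM2l//; apply: le_trans LM.
    apply: Lle; [by []|by apply/bm_indic/measurableC|move=> x].
    rewrite !indicE !mem_setE !in_itv/= in_setC mem_setE in_itv/= negb_and -leNgt -ltNge.
    have [xa|ax] := leP x a.
      have -> : x <= - M by lra.
      have -> : x <= b by lra.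
      by rewrite /= subrr subr0.
    have [xb|bx] := leP x b; first by rewrite subr0 subrr ler0n.
    have -> : M < x by lra.
    by rewrite orbT !subr0.
  have -> : B * (e / (2 * (B + 1))) = e / 2 * (B / (B + 1)).
    by field; rewrite lt0r_neq0.
  rewrite ler_piMr//; first by rewrite divr_ge0// ltW.
  by rewrite ler_pdivrMr// mul1r lerDl.
by lra.
Qed.

End lipschitz_test_functions.

Section weak_convergence.
Context d (T : measurableType d) (R : realType) (P : probability T R).
Variables (X : nat -> {RV P >-> R}) (mu : {RV P >-> pprobability R R}).
Hypothesis hmu : is_limit_random_measure X mu.

Lemma mixture_tight (eta : T -> R) (e : R) :
  bounded_measurable eta -> (forall w, 0 <= eta w) -> 0 < e ->
  exists M, \int[P]_w (eta w * \int[mu w]_x \1_(~` `]- M, M]) x) <= e.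
Proof.
move=> beta eta0 e0; have [meta [B etaB]] := beta.
have bM M : bounded_measurable (\1_(~` `]- M, M]) : R -> R).
  by apply: bm_indic; exact: measurableC.
have ind1 M x : `|\1_(~` `]- M, M]) x : R| <= 1.
  by rewrite indicE; case: (_ \in _); rewrite ?normr1 ?normr0.
have cvg_in w : \int[mu w]_x \1_(~` `]- n%:R, n%:R]) x @[n --> \oo] --> (0 : R).
  rewrite -[X in _ --> X](@prob_Rintegral_cst _ _ R (mu w)).
  apply: (@bounded_cvg_Rintegral _ _ _ (mu w) _ (fun=> 0) 1) => //.
    by move=> n; case: (bM n%:R).
  move=> x; apply: cvg_near_cst.
  near=> n; rewrite indicE in_setC mem_setE in_itv/=.
  have xn : `|x| < n%:R by near: n; exact: nbhs_infty_gtr.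
  by move: xn; rewrite ltr_norml => /andP[-> /ltW ->].
have : \int[P]_w (eta w * \int[mu w]_x \1_(~` `]- n%:R, n%:R]) x)
    @[n --> \oo] --> (0 : R).
  rewrite -[X in _ --> X](@prob_Rintegral_cst _ _ R P).
  apply: (@bounded_cvg_Rintegral _ _ _ _ _ (fun=> 0) B).
  - by move=> n; case: (bmM beta (bm_mixture mu (bM n%:R))).
  - move=> n w; rewrite normrM -[leRHS]mulr1 ler_pM//.
    by apply: bm_norm_Rintegral_cst.
  - by move=> w; rewrite -[X in _ --> X](mulr0 (eta w)); exact: cvgMr.
move/cvgrPdist_le => /(_ _ e0) [N _ /(_ N (leqnn N))] /=.
rewrite sub0r normrN => h; exists N%:R.
exact: le_trans (ler_norm _) h.
Unshelve. all: by end_near. Qed.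

(** Weak convergence in L^infty of the indicators of X n <= t says that the
    functionals sending f to E (eta f(X n)) converge on half-lines; they are
    positive because eta is nonnegative. *)
Lemma weighted_weak_cvg (eta : T -> R) (f : R -> R) (K : R) :
  bounded_measurable eta -> (forall w, 0 <= eta w) ->
  bounded_measurable f -> (forall x y, `|f x - f y| <= K * `|x - y|) ->
  \int[P]_w (eta w * f (X n w)) @[n --> \oo] -->
  \int[P]_w (eta w * \int[mu w]_x f x).
Proof.
move=> beta eta0 bf fK; have [nu [D [_ _ dD _ cD]]] := hmu.
have mX n : measurable_fun [set: T] (X n) by exact: measurable_funPT.
suff [] : convergent_on (fun n f => \int[P]_w (eta w * f (X n w)))
    (fun f => \int[P]_w (eta w * \int[mu w]_x f x)) f by [].
apply: (@convergent_on_Lipschitz _ _ _ _ _ D dD _ _ f K) => //.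
- by move=> n; exact: positive_weighted_integral_comp.
- exact: positive_mixture.
- split; first exact: bm_cst.
  under [X in _ --> X]eq_Rintegral => w _ do rewrite prob_Rintegral_cst.
  exact: cvg_cst.
- move=> t Dt; split; first by apply: bm_indic.
  have := cD _ Dt eta (bm_integrable P beta).
  rewrite unlock.
  have -> : (\int[P]_w (EFin \o ((fun w => dfun (mu w) t) \* eta)%R) w)%E =
     (\int[P]_w (eta w * \int[mu w]_x \1_(`]-oo, t]) x))%:E.
    rewrite /Rintegral fineK; last first.
      have bI : bounded_measurable (\1_(`]-oo, t]) : R -> R) by exact: bm_indic.
      have := bm_integrable P (bmM beta (bm_mixture mu bI)).
      exact: integrable_fin_num.
    apply: eq_integral => w _ /=.
    rewrite mulrC; congr (_ * _)%:E.
    by rewrite -[RHS]/(\int[mu w]_x \1_(`]-oo, t]) x) prob_Rintegral_indic.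
  move/fine_cvg.
  have -> // : fine \o (fun n : nat => (\int[P]_w
      (EFin \o (\1_[set w | X n w <= t] \* eta)%R) w)%E) =
    (fun n => \int[P]_w (eta w * \1_(`]-oo, t]) (X n w))).
  apply/funext => n; rewrite /= /Rintegral; congr fine.
  by apply: eq_integral => w _ /=; rewrite mulrC; congr (_ * _)%:E.
- by move=> e e0; exact: mixture_tight.
Qed.

Lemma weak_cvg_Lipschitz (eta : T -> R) (f : R -> R) (K : R) :
  bounded_measurable eta -> 
  bounded_measurable f -> (forall x y, `|f x - f y| <= K * `|x - y|) ->
  \int[P]_w (eta w * f (X n w)) @[n --> \oo] -->
  \int[P]_w (eta w * \int[mu w]_x f x).
Proof.
move=> beta bf fK; have [meta [B etaB]] := beta.
have mX n : measurable_fun [set: T] (X n) by exact: measurable_funPT.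
(* the weight eta is the difference of the nonnegative weights eta + B and B *)
have B0 w : 0 <= B := le_trans (normr_ge0 _) (etaB w).
have bB : bounded_measurable (fun w => eta w + B) by apply: bmD => //; exact: bm_cst.
have bfX n : bounded_measurable (fun w => f (X n w)) by exact: bm_comp.
have bfm := bm_mixture mu bf.
have split_weight (g : T -> R) : bounded_measurable g -> \int[P]_w (eta w * g w) =
    \int[P]_w ((eta w + B) * g w) - \int[P]_w (B * g w).
  move=> bg; rewrite -bm_RintegralB; [|exact: bmM|exact: bmM (bm_cst B) bg].
  by apply: eq_Rintegral => w _; rewrite mulrDl addrK.
rewrite split_weight//; under eq_fun do rewrite split_weight//.
have etaB0 w : 0 <= eta w + B.
  by rewrite -lerBlDr sub0r; have := etaB w; rewrite ler_norml => /andP[].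
apply: cvgB; first exact: (weighted_weak_cvg bB etaB0 bf fK).
exact: (weighted_weak_cvg (bm_cst B) B0 bf fK).
Qed.

End weak_convergence.

(** * Fubini's theorem and averages under uniform laws *)

Section bounded_fubini.
Context d1 d2 (T1 : measurableType d1) (T2 : measurableType d2) (R : realType).
Variables (P : probability T1 R) (Q : probability T2 R) (F : T1 * T2 -> R).
Hypothesis bF : bounded_measurable F.

Lemma bm_pair1 x : bounded_measurable (fun y => F (x, y)).
Proof. by apply: (bm_comp bF); exact: measurable_pair1. Qed.

Lemma bm_pair2 y : bounded_measurable (fun x => F (x, y)).
Proof. by apply: (bm_comp bF); exact: measurable_pair2. Qed.

Let integrable_prod : (P \x Q)%E.-integrable [set: T1 * T2] (EFin \o F).
Proof.
have [mF [M FM]] := bF.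
have mF' : measurable_fun [set: T1 * T2] (EFin \o F) by exact/measurable_EFinP.
apply/(integrable12ltyP P Q mF').
apply: (@le_lt_trans _ _ (\int[P]_x (cst M%:E) x)%E); last first.
  by rewrite integral_cst// [X in (_ * X)%E]probability_setT mule1 ltry.
apply: ge0_le_integral => //.
- by move=> x _; exact: integral_ge0.
- apply: (measurable_fun_fubini_tonelli_F (m2 := Q) (fun z => `|(F z)%:E|%E)) => //.
  exact: measurableT_comp.
- move=> x _; apply: (@le_trans _ _ (\int[Q]_y (cst M%:E) y)%E).
    apply: ge0_le_integral => //.
    + apply: measurableT_comp => //; apply/measurable_EFinP.
      by case: (bm_pair1 x).
    + by move=> y _; rewrite lee_fin.
  by rewrite integral_cst// [X in (_ * X)%E]probability_setT mule1.
Qed.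

Lemma bm_partial_Rintegral : bounded_measurable (fun x => \int[Q]_y F (x, y)).
Proof.
have [mF [M FM]] := bF; split; last first.
  by exists M => x; apply: bm_norm_Rintegral_cst => //; exact: bm_pair1.
apply: (@measurableT_comp _ _ _ _ _ _ (@fine R)) => //.
exact: (measurable_fubini_F integrable_prod).
Qed.

Lemma bm_Fubini :
  \int[P]_x \int[Q]_y F (x, y) = \int[Q]_y \int[P]_x F (x, y).
Proof.
have := Fubini integrable_prod; rewrite /= => FE.
rewrite /Rintegral -[in LHS](_ : (fun x => \int[Q]_y (F (x, y))%:E)%E =
  (fun x => (fine (\int[Q]_y (F (x, y))%:E))%:E)%E).
  rewrite FE; congr fine; apply: eq_integral => y _; rewrite fineK//.
  exact: (integrable_fin_num _ (bm_integrable P (bm_pair2 y))).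
apply/funext => x; rewrite fineK//.
exact: (integrable_fin_num _ (bm_integrable Q (bm_pair1 x))).
Qed.

End bounded_fubini.

(** The integrand f need only agree with a continuous derivative h on [a, b]: it
    is used for an f that is bounded on the whole line while h is not. *)
Lemma uniform_FTC (R : realType) (a b : R) (ab : a < b) (f h F : R -> R) :
  (forall x : R, is_derive x (1 : R) F (h x)) -> continuous h ->
  bounded_measurable f -> (forall x, a <= x <= b -> f x = h x) ->
  \int[uniform_prob ab]_x f x = (b - a)^-1 * (F b - F a).
Proof.
move=> dF ch bf fh; have [mf [K fK]] := bf.
have bfK : bounded_measurable (fun x => f x + K) by exact: bmD bf (bm_cst K).
have -> : \int[uniform_prob ab]_x f x = \int[uniform_prob ab]_x (f x + K) - K.
  rewrite bm_RintegralD//; last exact: bm_cst.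
  by rewrite prob_Rintegral_cst addrK.
have fK0 x : 0 <= f x + K.
  by rewrite -lerBlDr sub0r; have := fK x; rewrite ler_norml => /andP[].
pose FK := F \+ (K *: id).
have dFK (x : R) : is_derive x (1 : R) FK (h x + K).
  by apply: is_deriveD; rewrite -[X in is_derive _ _ _ X]mulr1; exact: is_deriveZ.
have cFK : continuous FK.
  move=> x; apply: differentiable_continuous.
  by apply/derivable1_diffP; case: (dFK x).
rewrite {1}/Rintegral integral_uniform//; last by apply/measurable_EFinP; case: bfK.
have -> : (\int[lebesgue_measure]_(x in `[a, b]) (f x + K)%:E =
    (FK b)%:E - (FK a)%:E)%E.
  rewrite -(@continuous_FTC2 _ (fun x => h x + K) FK a b ab).
  - by apply: eq_integral => x; rewrite inE/= in_itv/= => /fh ->.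
  - apply: continuous_subspaceT => x; apply: continuousD; first exact: ch.
    exact: cvg_cst.
  - split=> [x _||]; first by case: (dFK x).
    + exact/cvg_at_right_filter/cFK.
    + exact/cvg_at_left_filter/cFK.
  - by move=> x _; rewrite derive1E; exact: derive_val.
have FKE x : FK x = F x + K * x by [].
have ba : b - a != 0 by rewrite subr_eq0 gt_eqF.
rewrite -EFinB -EFinM /= !FKE.
by field.
Qed.

(** * The continuity theorem for characteristic functions *)

Section cauchy_kernel.
Variable R : realType.

Lemma laplace_cos_derivative (s z t : R) : 0 < s ->
  is_derive t (1 : R) (fun t => expR (- (s * t)) *
      (z * sin (t * z) - s * cos (t * z)) / (s ^+ 2 + z ^+ 2))
    (expR (- (s * t)) * cos (t * z)).
Proof.
move=> s0; have D0 : 0 < s ^+ 2 + z ^+ 2 by rewrite ltr_pwDl ?exprn_gt0 ?sqr_ge0.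
have dl (k : R) : is_derive t (1 : R) (fun t => t * k) k.
  have -> : (fun t => t * k) = k *: id by apply/funext => u; rewrite mulrC.
  by rewrite -[X in is_derive _ _ _ X]mulr1; exact: is_deriveZ.
have dc := @is_derive1_comp R cos (fun t => t * z) t _ _ (is_derive_cos _) (dl z).
have ds := @is_derive1_comp R sin (fun t => t * z) t _ _ (is_derive_sin _) (dl z).
have de := @is_derive1_comp R expR (fun t => t * (- s)) t _ _ (is_derive_expR _) (dl (- s)).
have dg := is_deriveZ (s ^+ 2 + z ^+ 2)^-1
  (is_deriveM de (is_deriveB (is_deriveZ z ds) (is_deriveZ s dc))).
pose g : R -> R := (s ^+ 2 + z ^+ 2)^-1 *: ((expR \o (fun t => t * - s)) *
  (z *: (sin \o (fun t => t * z)) - s *: (cos \o (fun t => t * z)))).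
rewrite (_ : (fun t => _) = g); last first.
  apply/funext => u; rewrite -[RHS]/((s ^+ 2 + z ^+ 2)^-1 *
    (expR (u * - s) * (z * sin (u * z) - s * cos (u * z)))).
  by rewrite mulrN [u * s]mulrC [RHS]mulrC.
apply: is_derive_eq => /=.
rewrite /GRing.scale/= -[(z \*: _ - s \*: _) t]/(z * sin (t * z) - s * cos (t * z)).
rewrite mulrN [t * s]mulrC.
by field; rewrite gt_eqF.
Qed.


Lemma atan_derivative (s y t : R) : 0 < s ->
  is_derive t (1 : R) (fun t => atan ((t - y) / s)) (s / (s ^+ 2 + (y - t) ^+ 2)).
Proof.
move=> s0; have D0 : 0 < s ^+ 2 + (y - t) ^+ 2.
  by rewrite ltr_pwDl ?exprn_gt0 ?sqr_ge0.
have dl : is_derive t (1 : R) (fun t => (t - y) / s) s^-1.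
  have -> : (fun t => (t - y) / s) = s^-1 *: (id + cst (- y)).
    by apply/funext => u; rewrite mulrC.
  have := is_deriveZ s^-1 (is_deriveD (is_derive_id t (1 : R)) (is_derive_cst (- y) t (1 : R))).
  by rewrite addr0 [_ *: 1]mulr1.
have := @is_derive1_comp R atan (fun t => (t - y) / s) t _ _ (is_derive1_atan _) dl.
move=> /is_derive_eq; apply.
rewrite -[y - t]opprB sqrrN.
have D1 : 0 < s ^+ 2 + (t - y) ^+ 2 by rewrite ltr_pwDl ?exprn_gt0 ?sqr_ge0.
field; rewrite !gt_eqF//=.
Qed.

Lemma bm_cauchy (s : R) : 0 < s ->
  bounded_measurable (fun z : R => s / (s ^+ 2 + z ^+ 2)).
Proof.
move=> s0; have D0 (z : R) : 0 < s ^+ 2 + z ^+ 2 by rewrite ltr_pwDl ?exprn_gt0 ?sqr_ge0.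
split.
  apply: continuous_measurable_fun => z; apply: cvgMr.
  apply: cvgV; first by rewrite gt_eqF.
  by apply: cvgD; [exact: cvg_cst|exact: exprn_continuous].
exists s^-1 => z; rewrite ger0_norm; last by rewrite divr_ge0// ltW.
rewrite ler_pdivrMr// mulrDr expr2 mulrA mulVf ?gt_eqF// mul1r lerDl.
by apply: mulr_ge0; [rewrite invr_ge0 ltW|exact: sqr_ge0].
Qed.

End cauchy_kernel.

Section levy_continuity.
Context d (T : measurableType d) (R : realType) (P : probability T R).
Variables (Y : nat -> T -> R) (G : probability R R).
Hypothesis mY : forall n, measurable_fun [set: T] (Y n).

Let L_ n (f : R -> R) := \int[P]_w f (Y n w).
Let L (f : R -> R) := \int[G]_x f x.
Let pL_ n : positive_functional (L_ n) := positive_integral_comp P (mY n).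
Let pL : positive_functional L := positive_integral_comp G (@measurable_id _ _ setT).

(** By Fubini's theorem the average over t can be taken after the integral in y,
    where dominated convergence applies. *)
Lemma convergent_on_average d' (T' : measurableType d') (Q : probability T' R)
    (F : T' * R -> R) :
  bounded_measurable F ->
  (forall t, convergent_on L_ L (fun y => F (t, y))) ->
  convergent_on L_ L (fun y => \int[Q]_t F (t, y)).
Proof.
move=> bF cF; have [mF [M FM]] := bF.
have bFs : bounded_measurable (fun p : R * T' => F (p.2, p.1)).
  by apply: (bm_comp bF); exact: measurable_swap.
have bFY n : bounded_measurable (fun p : T' * T => F (p.1, Y n p.2)).
  apply: (bm_comp bF); apply: measurable_fun_pair => //.
  exact: measurableT_comp.
have bFYs n : bounded_measurable (fun p : T * T' => F (p.2, Y n p.1)).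
  apply: (bm_comp bF); apply: measurable_fun_pair => //.
  exact: measurableT_comp.
split; first exact: (bm_partial_Rintegral G Q bFs).
rewrite /L (bm_Fubini G Q bFs).
have -> : (fun n => L_ n (fun y => \int[Q]_t F (t, y))) =
    (fun n => \int[Q]_t L_ n (fun y => F (t, y))).
  by apply/funext => n; exact: (bm_Fubini P Q (bFYs n)).
apply: (@bounded_cvg_Rintegral _ _ _ _ _ _ M).
- by move=> n; case: (bm_partial_Rintegral Q P (bFY n)).
- move=> n t; apply: bm_norm_Rintegral_cst => //.
  exact: (bm_pair1 (bFY n) t).
- by move=> t; case: (cF t).
Qed.

Hypothesis cos_cvg : forall t theta,
  \int[P]_w cos (t * Y n w + theta) @[n --> \oo] -->
  \int[G]_x cos (t * x + theta).

Let bm_cos_affine t theta : bounded_measurable (fun x : R => cos (t * x + theta)).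
Proof.
split; last by exists 1 => x; rewrite ler_norml cos_geN1 cos_le1.
apply: continuous_measurable_fun => x.
apply: continuous_comp; last exact: continuous_cos.
by apply: cvgD; [exact: cvgMr|exact: cvg_cst].
Qed.

Let convergent_on_cos t theta : convergent_on L_ L (fun x => cos (t * x + theta)).
Proof. by split; [exact: bm_cos_affine|exact: cos_cvg]. Qed.

Let convergent_on_cst k : convergent_on L_ L (fun=> k).
Proof.
have := convergent_onZ pL_ pL k (convergent_on_cos 0 0).
by congr convergent_on; apply/funext => x; rewrite mul0r add0r cos0 mulr1.
Qed.

(** Up to the error e^(-sM), the Cauchy kernel is the integral over [0, M] of
    the cosines cos (t (y - x)) with weights e^(-st). *)
Lemma convergent_on_cauchy (s x : R) : 0 < s ->
  convergent_on L_ L (fun y => s / (s ^+ 2 + (y - x) ^+ 2)).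
Proof.
move=> s0; apply: convergent_on_sandwich => //.
  by apply: (bm_comp (bm_cauchy s0)); apply: measurable_funB => //; exact: measurable_cst.
move=> e e0.
pose M := 2 / (s ^+ 2 * e).
have M0 : 0 < M by rewrite divr_gt0// mulr_gt0// exprn_gt0.
(* the weight e^(-s |t|) makes F bounded for all t; only t in [0, M] matters *)
pose F (p : measurableTypeR R * R) := expR (- (s * `|p.1|)) * cos (p.1 * (p.2 - x)).
have bF : bounded_measurable F.
  split; last first.
    exists 1 => p; rewrite normrM -[leRHS]mulr1 ler_pM//.
      rewrite ger0_norm ?expR_ge0// -expR0 ler_expR oppr_le0.
      by rewrite mulr_ge0// ltW.
    by rewrite ler_norml cos_geN1 cos_le1.
  apply: measurable_funM.
    apply: (@measurableT_comp _ _ _ _ _ _ (fun t : R => expR (- (s * `|t|)))) => //.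
    apply: measurableT_comp => //; apply: measurableT_comp => //.
    by apply: measurable_funM => //; exact: measurable_cst.
  apply: measurableT_comp; first exact: (continuous_measurable_fun (@continuous_cos R)).
  apply: measurable_funM => //; apply: measurable_funB => //; exact: measurable_cst.
have cF t : convergent_on L_ L (fun y => F (t, y)).
  have := convergent_onZ pL_ pL (expR (- (s * `|t|))) (convergent_on_cos t (- (t * x))).
  by congr convergent_on; apply/funext => y; rewrite /F/= mulrBr.
exists (fun y => M * \int[uniform_prob M0]_t F (t, y)), (fun=> e); split.
- exact: (convergent_onZ pL_ pL M (convergent_on_average (uniform_prob M0) bF cF)).
- exact: convergent_on_cst.
- move=> y; set z := y - x.
  have D0 : 0 < s ^+ 2 + z ^+ 2 by rewrite ltr_pwDl ?exprn_gt0 ?sqr_ge0.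
  pose A t := expR (- (s * t)) * (z * sin (t * z) - s * cos (t * z)) / (s ^+ 2 + z ^+ 2).
  pose h t := expR (- (s * t)) * cos (t * z).
  rewrite (@uniform_FTC R 0 M M0 (fun t => F (t, y)) h A
    (fun t => laplace_cos_derivative z t s0)); last 3 first.
  + move=> t; apply: cvgM.
      apply: continuous_comp; last exact: continuous_expR.
      by apply: cvgN; apply: cvgMr.
    apply: continuous_comp; last exact: continuous_cos.
    by apply: cvgMl.
  + exact: bm_pair2 bF y.
  + by move=> t /andP[t0 _]; rewrite /F/h/= ger0_norm.
  rewrite subr0 mulrA divff ?gt_eqF// mul1r /A mulr0 oppr0 expR0 !mul0r sin0 cos0.
  have -> : s / (s ^+ 2 + z ^+ 2) -
    (expR (- (s * M)) * (z * sin (M * z) - s * cos (M * z)) / (s ^+ 2 + z ^+ 2) -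
     1 * (z * 0 - s * 1) / (s ^+ 2 + z ^+ 2)) =
    expR (- (s * M)) * ((s * cos (M * z) - z * sin (M * z)) / (s ^+ 2 + z ^+ 2)).
    by field; rewrite gt_eqF.
  rewrite normrM (ger0_norm (expR_ge0 _)).
  have h1 : `|(s * cos (M * z) - z * sin (M * z)) / (s ^+ 2 + z ^+ 2)| <= 2 / s.
    rewrite normrM normfV (gtr0_norm D0) ler_pdivrMr// [leRHS]mulrAC ler_pdivlMr//.
    have h2 : `|s * cos (M * z) - z * sin (M * z)| <= s + `|z|.
      rewrite (le_trans (ler_normB _ _))// !normrM (gtr0_norm s0).
      apply: lerD; rewrite -[leRHS]mulr1; apply: ler_pM => //; rewrite ?(ltW s0)//.
        by rewrite ler_norml cos_geN1 cos_le1.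
      by rewrite ler_norml sin_geN1 sin_le1.
    have : `|s * cos (M * z) - z * sin (M * z)| * s <= (s + `|z|) * s.
      by rewrite ler_pM2r.
    move=> /le_trans; apply; rewrite -(real_normK (num_real z)).
    have := sqr_ge0 (s - `|z|); have := sqr_ge0 `|z|; have := sqr_ge0 s.
    by rewrite sqrrB mulr2n !mulrDr; lra.
  have h2 : expR (- (s * M)) <= (s * M)^-1.
    have sM : 0 < s * M by exact: mulr_gt0.
    rewrite expRN lef_pV2 ?posrE ?expR_gt0//.
    by apply: le_trans (expR_ge1Dx _); lra.
  have h3 := ler_pM (expR_ge0 _) (normr_ge0 _) h2 h1.
  apply: le_trans h3 _.
  rewrite /M; have -> // : (s * (2 / (s ^+ 2 * e)))^-1 * (2 / s) = e.
  by field; rewrite !gt_eqF.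
- by rewrite /L prob_Rintegral_cst.
Qed.

(** Averaging the Cauchy kernel over its centre x in [a, b] gives a difference
    of arc tangents, since the kernel is also the derivative in x of
    atan ((x - y) / s). *)
Lemma convergent_on_atan (s a b : R) : 0 < s -> a < b ->
  convergent_on L_ L (fun y => atan ((b - y) / s) - atan ((a - y) / s)).
Proof.
move=> s0 ab; pose F (p : measurableTypeR R * R) := s / (s ^+ 2 + (p.2 - p.1) ^+ 2).
have bF : bounded_measurable F.
  by apply: (bm_comp (bm_cauchy s0)); exact: measurable_funB.
have := convergent_onZ pL_ pL (b - a) (convergent_on_average (uniform_prob ab) bF
  (fun t => convergent_on_cauchy t s0)).
congr convergent_on; apply/funext => y.
rewrite (@uniform_FTC R a b ab (fun t => F (t, y)) (fun t => F (t, y)) _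
  (fun t => atan_derivative y t s0)) //.
- by rewrite mulrA divff ?mul1r// subr_eq0 gt_eqF.
- move=> t; apply: cvgMr; apply: cvgV.
    by rewrite gt_eqF// ltr_pwDl ?exprn_gt0 ?sqr_ge0.
  apply: cvgD; first exact: cvg_cst.
  apply: (@continuous_comp _ _ _ (fun t : R => y - t) (fun u : R => u ^+ 2)).
    by apply: cvgB => //; exact: cvg_cst.
  exact: exprn_continuous.
- exact: bm_pair2 bF y.
Qed.

Lemma atan_tail (e : R) : 0 < e ->
  exists2 u0, 0 < u0 & forall u, u0 <= u -> 1 / 2 - atan u / pi <= e.
Proof.
move=> e0; have pi0 := pi_gt0 R.
have /cvgrPdist_le /(_ (e * pi)) [] := @cvgy_atan R; first exact: mulr_gt0.
move=> N [_ HN]; exists (`|N| + 1); first by rewrite ltr_pwDr.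
move=> u Nu; have /HN : N < u.
  by apply: lt_le_trans Nu; rewrite ltr_pwDr// ler_norm.
rewrite /= ger0_norm ?subr_ge0; last by rewrite ltW// atan_ltpi2.
move=> h; rewrite -(ler_pM2r pi0) mulrBl divfK ?gt_eqF//.
by rewrite div1r mulrC; lra.
Qed.

(** In y, this is the survival function of the Cauchy law with centre a and scale
    s; as s tends to 0 it tends to the indicator of y <= a away from y = a. *)
Let smooth_step (s a y : R) := atan ((a - y) / s) / pi + 1 / 2.

Let step01 s a y : 0 <= smooth_step s a y <= 1.
Proof.
have pi0 := pi_gt0 R; have h1 := atan_gtNpi2 ((a - y) / s).
have h2 := atan_ltpi2 ((a - y) / s).
rewrite /smooth_step; move: (atan _) h1 h2 => A h1 h2.
have -> : A / pi + 1 / 2 = (A + pi / 2) / pi.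
  by rewrite mulrDl [pi / 2 / _]mulrAC divff ?gt_eqF.
by rewrite ler_pdivlMr// ler_pdivrMr// mul0r mul1r; apply/andP; split; lra.
Qed.

Let convergent_on_step s a b : 0 < s -> a < b ->
  convergent_on L_ L (fun y => smooth_step s b y - smooth_step s a y).
Proof.
move=> s0 ab; have := convergent_onZ pL_ pL pi^-1 (convergent_on_atan s0 ab).
congr convergent_on; apply/funext => y; rewrite /smooth_step.
by rewrite mulrC mulrBl; lra.
Qed.

(** Within r of the endpoint t the error is at most 1/2, and the Cauchy bump is
    at least 1/2 there; farther away the tail of the arc tangent is at most r. *)
Let smooth_step_close (r s t y : R) : 0 < r -> 0 < s ->
  (forall u, r / s <= u -> 1 / 2 - atan u / pi <= r) ->
  `|\1_`]-oo, t] y - smooth_step s t y| <= r + r ^+ 2 / (r ^+ 2 + (y - t) ^+ 2).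
Proof.
move=> r0 s0 tail; have pi0 := pi_gt0 R.
have D0 : 0 < r ^+ 2 + (y - t) ^+ 2 by rewrite ltr_pwDl ?exprn_gt0 ?sqr_ge0.
have B0 : 0 <= r ^+ 2 / (r ^+ 2 + (y - t) ^+ 2).
  by rewrite divr_ge0 ?sqr_ge0// ltW.
have /andP[F0 F1] := step01 s t y.
rewrite indicE mem_setE in_itv/=.
have [yr|ry] := leP `|y - t| r.
  have B2 : 1 / 2 <= r ^+ 2 / (r ^+ 2 + (y - t) ^+ 2).
    rewrite ler_pdivlMr//.
    have : (y - t) ^+ 2 <= r ^+ 2.
      by rewrite -(real_normK (num_real (y - t))) lerXn2r// nnegrE// ltW.
    by lra.
  have [yt|ty] := leP y t.
    have : 0 <= atan ((t - y) / s) / pi.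
      rewrite divr_ge0 ?(ltW pi0)// -(@atan0 R) le_atan// divr_ge0 ?(ltW s0)//.
      by rewrite subr_ge0.
    by move=> h; rewrite ler_norml; apply/andP; split; rewrite /smooth_step /= in F1 *; lra.
  have : atan ((t - y) / s) / pi <= 0.
    rewrite pmulr_lle0 ?invr_gt0// -(@atan0 R) le_atan// pmulr_lle0 ?invr_gt0//.
    by rewrite subr_le0 ltW.
  by move=> h; rewrite ler_norml; apply/andP; split; rewrite /smooth_step /= in F0 *; lra.
have [yt|ty] := leP y t.
  have := tail ((t - y) / s); rewrite ler_pM2r ?invr_gt0//.
  have -> : r <= t - y by move: ry; rewrite distrC ger0_norm ?subr_ge0//; exact: ltW.
  move=> /(_ isT) h; rewrite ler_norml; apply/andP; split.
    by rewrite /= in F1 *; lra.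
  by rewrite /smooth_step /=; lra.
have := tail ((y - t) / s); rewrite ler_pM2r ?invr_gt0//.
have -> : r <= y - t by move: ry; rewrite gtr0_norm ?subr_gt0//; exact: ltW.
move=> /(_ isT) h.
have E : (y - t) / s = - ((t - y) / s) by rewrite -mulNr opprB.
rewrite E atanN mulNr in h.
rewrite ler_norml; apply/andP; split; rewrite /smooth_step /= in F0 *; lra.
Qed.

Let no_atom t e : continuity_pt G t -> 0 < e -> \int[G]_x \1_[set t] x <= e.
Proof.
move=> ct e0; move/cvgrPdist_le : (ct) => /(_ _ e0) [dl /= dl0 Hdl].
have bI (u : R) : bounded_measurable (\1_(`]-oo, u]) : R -> R) by exact: bm_indic.
have bt : bounded_measurable (\1_[set t] : R -> R) by exact: bm_indic.
have /ler_normlP[_] : `|dfun G t - dfun G (t - dl / 2)| <= e.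
  apply: Hdl => /=.
  have -> : t - (t - dl / 2) = dl / 2 by lra.
  by rewrite gtr0_norm; lra.
apply: le_trans; rewrite /dfun -!prob_Rintegral_indic// -bm_RintegralB//.
apply: bm_le_Rintegral => // [|x]; first exact: bmB.
rewrite !indicE !mem_setE !in_itv/=.
have [->|xt] := eqVneq x t.
  rewrite mem_set// lexx (_ : (t <= t - dl / 2) = false) ?subr0//.
  by apply/negbTE; rewrite -ltNge; lra.
rewrite memNset; last exact/eqP.
rewrite subr_ge0; have [xd|//] := leP x (t - dl / 2).
by have -> : x <= t by lra.
Qed.

Let bump_small t e : continuity_pt G t -> 0 < e ->
  exists2 r, 0 < r & r + \int[G]_x (r ^+ 2 / (r ^+ 2 + (x - t) ^+ 2)) <= e.
Proof.
move=> ct e0; pose r n : R := n.+1%:R^-1.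
have r0 n : 0 < r n by rewrite invr_gt0.
have bB (s : R) : 0 < s ->
    bounded_measurable (fun x : R => s ^+ 2 / (s ^+ 2 + (x - t) ^+ 2)).
  move=> s0; have mt : measurable_fun [set: R] (fun x : R => x - t).
    by apply: measurable_funB => //; exact: measurable_cst.
  have := bmM (bm_cst s) (bm_comp (bm_cauchy s0) mt).
  by congr bounded_measurable; apply/funext => x; rewrite mulrA -expr2.
have rc : r n @[n --> \oo] --> (0 : R) by exact: cvg_harmonic.
have : r n + \int[G]_x (r n ^+ 2 / (r n ^+ 2 + (x - t) ^+ 2)) @[n --> \oo] -->
    0 + \int[G]_x \1_[set t] x.
  apply: cvgD => //; apply: (@bounded_cvg_Rintegral _ _ _ _ _ _ 1).
  - by move=> n; case: (bB _ (r0 n)).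
  - move=> n x; have D0 : 0 < r n ^+ 2 + (x - t) ^+ 2.
      by rewrite ltr_pwDl ?exprn_gt0 ?sqr_ge0.
    rewrite ger0_norm; last by apply: divr_ge0; [exact: sqr_ge0|exact: ltW].
    by rewrite ler_pdivrMr// mul1r lerDl sqr_ge0.
  - move=> x; rewrite indicE; have [->|xt] := eqVneq x t.
      rewrite mem_set//= subrr expr0n/=.
      under eq_fun do rewrite addr0 divff ?expf_neq0 ?gt_eqF//.
      exact: cvg_cst.
    rewrite memNset; last exact/eqP.
    have xt0 : 0 ^+ 2 + (x - t) ^+ 2 != 0.
      by rewrite expr0n/= add0r expf_neq0// subr_eq0.
    have -> : false%:R = 0 ^+ 2 / (0 ^+ 2 + (x - t) ^+ 2) :> R by rewrite !expr0n/= mul0r.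
    have r2 : r n ^+ 2 @[n --> \oo] --> (0 ^+ 2 : R).
      by rewrite !expr2; apply: cvgM.
    apply: cvgM => //; apply: cvgV => //; apply: cvgD => //; exact: cvg_cst.
rewrite add0r => /cvgrPdist_le /(_ (e / 2)) []; first by rewrite divr_gt0.
move=> N _ /(_ N (leqnn N)) /ler_normlP[h _]; exists (r N) => //.
have := @no_atom t (e / 2) ct; rewrite divr_gt0// => /(_ isT) => h'.
by lra.
Qed.

Let far_small (s t e : R) : 0 < s -> 0 < e ->
  exists2 K, `|t| < K & \int[G]_x (1 - (smooth_step s K x - smooth_step s (- K) x)) <= e.
Proof.
move=> s0 e0.
have bF (K : R) : bounded_measurable (fun x => 1 - (smooth_step s K x - smooth_step s (- K) x)).
  have bF1 (a : R) : bounded_measurable (smooth_step s a).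
    split; last first.
      exists 1 => x; have /andP[h1 h2] := step01 s a x.
      by rewrite ger0_norm.
    apply: continuous_measurable_fun => x; apply: cvgD; last exact: cvg_cst.
    apply: cvgMl; apply: (@continuous_comp _ _ _ (fun x => (a - x) / s)).
      by apply: cvgMl; apply: cvgB => //; exact: cvg_cst.
    exact: continuous_atan.
  exact: bmB (bm_cst 1) (bmB (bF1 _) (bF1 _)).
have lb K x : 0 <= K -> 0 <= 1 - (smooth_step s K x - smooth_step s (- K) x) <= 1.
  move=> K0; have /andP[h1 h2] := step01 s K x; have /andP[h3 h4] := step01 s (- K) x.
  have le_F : smooth_step s (- K) x <= smooth_step s K x.
    rewrite lerD2r ler_pM2r ?invr_gt0 ?pi_gt0// le_atan// ler_pM2r ?invr_gt0//.
    by lra.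
  by apply/andP; split; lra.
have : \int[G]_x (1 - (smooth_step s n%:R x - smooth_step s (- n%:R) x)) @[n --> \oo] --> (0 : R).
  rewrite -[X in _ --> X](@prob_Rintegral_cst _ _ R G).
  apply: (@bounded_cvg_Rintegral _ _ _ _ _ (fun=> 0) 1).
  - by move=> n; case: (bF n%:R).
  - by move=> n x; have /andP[h1 h2] := lb n%:R x (ler0n _ _); rewrite ger0_norm.
  - move=> x; apply/cvgrPdist_le => q q0.
    have [|u0 u00 tail] := @atan_tail (q / 2); first by rewrite divr_gt0.
    near=> n.
    have hn : u0 * s + `|x| <= n%:R by near: n; exact: nbhs_infty_ger.
    have /andP[h1 h2] := lb n%:R x (ler0n _ _).
    rewrite sub0r normrN ger0_norm// /smooth_step.
    have -> : (- n%:R - x) / s = - ((n%:R + x) / s) by rewrite -mulNr opprD.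
    have t1 := tail ((n%:R - x) / s); rewrite ler_pdivlMr// in t1.
    have t2 := tail ((n%:R + x) / s); rewrite ler_pdivlMr// in t2.
    have x1 := ler_norm x; have x2 := ler_normr x (- x).
    have x3 : - x <= `|x| by rewrite -normrN ler_norm.
    rewrite atanN mulNr.
    have {}t1 : 1 / 2 - atan ((n%:R - x) / s) / pi <= q / 2 by apply: t1; lra.
    have {}t2 : 1 / 2 - atan ((n%:R + x) / s) / pi <= q / 2 by apply: t2; lra.
    by lra.
move/cvgrPdist_le => /(_ _ e0) cI.
near \oo => n; exists n%:R; first by near: n; exact: nbhs_infty_gtr.
have : `|0 - \int[G]_x (1 - (smooth_step s n%:R x - smooth_step s (- n%:R) x))| <= e by near: n.
by rewrite sub0r normrN; apply: le_trans; exact: ler_norm.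
Unshelve. all: by end_near. Qed.

(** Levy's continuity theorem, with the characteristic function given through
    the means of all the phase-shifted cosines. At a continuity point t of the
    limit, the indicator of the half-line is sandwiched between test functions
    built from arc tangents and a Cauchy bump at t. *)
Lemma levy_continuity : cvg_in_distribution P Y G.
Proof.
move=> t ct.
have EL n : fine (P [set w | Y n w <= t]) = L_ n \1_(`]-oo, t]).
  rewrite -prob_Rintegral_indic.
    apply: eq_Rintegral => w _; rewrite !indicE.
    have -> // : (w \in [set v | Y n v <= t]) = (Y n w \in `]-oo, t]%classic).
    by apply/idP/idP; rewrite !inE /= ?in_itv.
  rewrite [X in measurable X](_ : _ = setT `&` Y n @^-1` `]-oo, t]).
    by apply: mY => //; exact: measurable_itv.
  by rewrite setTI; apply/seteqP; split => w /=; rewrite in_itv.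
under eq_fun do rewrite EL.
rewrite /dfun -prob_Rintegral_indic//.
suff [] : convergent_on L_ L \1_(`]-oo, t]) by [].
apply: convergent_on_sandwich => //; first exact: bm_indic.
move=> e e0; have e2 : 0 < e / 2 by rewrite divr_gt0.
have [r r0 re] := bump_small ct e2.
have [u0 u00 tail] := atan_tail r0.
(* the scale is so small that the tail of the arc tangent beyond r / s is at most r *)
pose s := r / u0; have s0 : 0 < s by rewrite divr_gt0.
have rs : r / s = u0 by rewrite /s invf_div mulrC divfK// gt_eqF.
have [K tK Ke] := far_small t s0 e2.
have {}tK : - K < t < K by rewrite -ltr_norml.
have /andP[Kt tK'] := tK.
have KK : - K < K by lra.
have c1 : convergent_on L_ L (fun y => r + r ^+ 2 / (r ^+ 2 + (y - t) ^+ 2)).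
  have := convergent_onD pL_ pL (convergent_on_cst r)
    (convergent_onZ pL_ pL r (convergent_on_cauchy t r0)).
  by congr convergent_on; apply/funext => y; rewrite mulrA -expr2.
have c2 : convergent_on L_ L (fun y => 1 - (smooth_step s K y - smooth_step s (- K) y)).
  exact: (convergent_onB pL_ pL (convergent_on_cst 1) (convergent_on_step s0 KK)).
exists (fun y => smooth_step s t y - smooth_step s (- K) y),
  (fun y => (r + r ^+ 2 / (r ^+ 2 + (y - t) ^+ 2)) +
    (1 - (smooth_step s K y - smooth_step s (- K) y))).
split.
- exact: convergent_on_step.
- exact: convergent_onD.
- move=> y; have h := @smooth_step_close r s t y r0 s0.
  rewrite rs in h; have {}h := h tail.
  have /andP[h1 h2] := step01 s K y; have /andP[h3 h4] := step01 s (- K) y.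
  move: h; rewrite !ler_norml => /andP[h5 h6].
  by apply/andP; split; lra.
have [b1 _] := c1; have [b2 _] := c2.
rewrite /L bm_RintegralD//.
have -> : \int[G]_x (r + r ^+ 2 / (r ^+ 2 + (x - t) ^+ 2)) =
   r + \int[G]_x (r ^+ 2 / (r ^+ 2 + (x - t) ^+ 2)).
  rewrite bm_RintegralD ?prob_Rintegral_cst//; first exact: bm_cst.
  have := bmB b1 (bm_cst r).
  by congr bounded_measurable; apply/funext => y; rewrite addrC addKr.
by lra.
Qed.

End levy_continuity.

(** * Uniformity of the weak convergence in the coefficients *)

Section trigonometric_functions.
Variable R : realType.

(** The real and the imaginary part of e^(ix), indexed so that one estimate
    covers both. *)
Definition trig (b : bool) (x : R) : R := if b then sin x else cos x.

Lemma trig_le1 b x : `|trig b x| <= 1.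
Proof.
by case: b; rewrite /trig ler_norml ?sin_geN1 ?sin_le1 ?cos_geN1 ?cos_le1.
Qed.

Lemma continuous_trig b : continuous (trig b).
Proof. by case: b; [exact: continuous_sin|exact: continuous_cos]. Qed.

Lemma trig_lipschitz b x y : `|trig b x - trig b y| <= `|x - y|.
Proof.
wlog xy : x y / y <= x.
  move=> h; have [|/ltW] := leP y x; first exact: h.
  by move=> /h; rewrite distrC [leRHS]distrC.
pose dt (z : R) := if b then cos z else - sin z.
have dtrig (z : R) : is_derive z (1 : R) (trig b) (dt z).
  by rewrite /dt /trig; case: (b); [exact: is_derive_sin|exact: is_derive_cos].
have [|c _ ->] := @MVT_segment R (trig b) dt y x xy (fun z _ => dtrig z).
  exact/continuous_subspaceT/continuous_trig.
rewrite normrM ler_piMl// /dt; case: (b); first exact: (trig_le1 false).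
by rewrite normrN; exact: (trig_le1 true).
Qed.

Lemma bm_trig b k : bounded_measurable (fun x : R => trig b (k * x)).
Proof.
split; last by exists 1 => x; exact: trig_le1.
apply: continuous_measurable_fun => x.
by apply: continuous_comp; [exact: cvgMr|exact: continuous_trig].
Qed.

(** A bounded Lipschitz modulus of continuity for sine and cosine; its mean is
    small as soon as its argument is small in probability. *)
Definition truncated_norm (x : R) : R := Num.min 2 `|x|.

Lemma truncated_norm_ge0 x : 0 <= truncated_norm x.
Proof. by rewrite /truncated_norm le_min normr_ge0 ler0n. Qed.

Lemma truncated_norm_le2 x : truncated_norm x <= 2.
Proof. by rewrite /truncated_norm ge_min lexx. Qed.

Lemma le_truncated_norm x y : `|x| <= `|y| -> truncated_norm x <= truncated_norm y.
Proof.
move=> xy; rewrite /truncated_norm le_min ge_min lexx /=.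
by rewrite ge_min xy orbT.
Qed.

Lemma truncated_norm_lipschitz x y :
  `|truncated_norm x - truncated_norm y| <= `|x - y|.
Proof.
have h := ler_dist_dist x y; move: h; rewrite /truncated_norm !ler_norml.
rewrite !minEle; have [h1|h1] := leP 2 `|x|; have [h2|h2] := leP 2 `|y|;
  move=> /andP[h3 h4]; apply/andP; split; lra.
Qed.

Lemma bm_truncated_norm k : bounded_measurable (fun x : R => truncated_norm (k * x)).
Proof.
split; last first.
  exists 2 => x; rewrite ger0_norm ?truncated_norm_ge0//.
  exact: truncated_norm_le2.
apply: measurable_minr; first exact: measurable_cst.
by apply: measurableT_comp.
Qed.

Lemma trig_truncated_norm b x y : `|trig b x - trig b y| <= truncated_norm (x - y).
Proof.
rewrite /truncated_norm le_min trig_lipschitz andbT.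
by rewrite (le_trans (ler_normB _ _))// lerD ?trig_le1.
Qed.

End trigonometric_functions.

Section uniform_weak_convergence.
Context d (T : measurableType d) (R : realType) (P : probability T R).
Variables (X : nat -> {RV P >-> R}) (mu : {RV P >-> pprobability R R}).
Hypothesis hmu : is_limit_random_measure X mu.

Variables (eta : T -> R) (Z : nat -> T -> R) (k : nat).
Hypothesis beta : bounded_measurable eta.
Hypothesis eta1 : forall w, `|eta w| <= 1.
Hypothesis mZ : forall j, measurable_fun [set: T] (Z j).

Definition linear_combination (s : nat -> R) (w : T) : R :=
  \sum_(j < k) s j * Z j w.

(** If X n had the conditional law mu given eta, mu and the variables Z j with
    j < k, this would vanish. *)
Definition mixing_defect (n : nat) (s : nat -> R) (b b' : bool) : R :=
  \int[P]_w (eta w * trig b (linear_combination s w) *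
    (trig b' (s k * X n w) - \int[mu w]_x trig b' (s k * x))).

Let mX n : measurable_fun [set: T] (X n).
Proof. exact: measurable_funPT. Qed.

Lemma measurable_linear_combination s :
  measurable_fun [set: T] (linear_combination s).
Proof.
rewrite /linear_combination.
apply: (@measurable_sum _ _ _ _ _ _ (fun j : 'I_k => fun w => s j * Z j w)) => j.
by apply: measurable_funM => //; exact: measurable_cst.
Qed.

Let bm_past s b :
  bounded_measurable (fun w => eta w * trig b (linear_combination s w)).
Proof.
apply: bmM => //.
have := bm_comp (bm_trig b 1) (measurable_linear_combination s).
by congr bounded_measurable; apply/funext => w; rewrite mul1r.
Qed.

Let bm_present n s b' :
  bounded_measurable (fun w => trig b' (s k * X n w) - \int[mu w]_x trig b' (s k * x)).
Proof.
apply: bmB; first exact: (bm_comp (bm_trig b' (s k)) (mX n)).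
exact: (bm_mixture mu (bm_trig b' (s k))).
Qed.

Let bm_integrand n s b b' :
  bounded_measurable (fun w => eta w * trig b (linear_combination s w) *
    (trig b' (s k * X n w) - \int[mu w]_x trig b' (s k * x))).
Proof. exact: bmM (bm_past s b) (bm_present n s b'). Qed.

Let mixing_defect_cvg s b b' : mixing_defect n s b b' @[n --> \oo] --> (0 : R).
Proof.
have lip x y : `|trig b' (s k * x) - trig b' (s k * y)| <= `|s k| * `|x - y|.
  by rewrite -normrM mulrBr; exact: trig_lipschitz.
have := weak_cvg_Lipschitz hmu (bm_past s b) (bm_trig b' (s k)) lip.
set l := Rintegral _ _ _ => cl.
have -> : mixing_defect ^~ s ^~ b ^~ b' = (fun n => \int[P]_w
    (eta w * trig b (linear_combination s w) * trig b' (s k * X n w)) - l).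
  apply/funext => n; rewrite /mixing_defect /l -bm_RintegralB.
  - by apply: eq_Rintegral => w _; rewrite mulrBr.
  - exact: bmM (bm_past s b) (bm_comp (bm_trig b' (s k)) (mX n)).
  - exact: bmM (bm_past s b) (bm_mixture mu (bm_trig b' (s k))).
by rewrite -[X in _ --> X](subrr l); apply: cvgB => //; exact: cvg_cst.
Qed.

Let past_norm w := \sum_(j < k) `|Z j w|.

Let measurable_past_norm : measurable_fun [set: T] past_norm.
Proof.
apply: (@measurable_sum _ _ _ _ _ _ (fun j : 'I_k => fun w => `|Z j w|)) => j.
exact: measurableT_comp.
Qed.

Let defect_modulus (dl : R) n := 2 * \int[P]_w truncated_norm (dl * past_norm w) +
  \int[P]_w truncated_norm (dl * X n w) +
  \int[P]_w \int[mu w]_x truncated_norm (dl * x).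

Let bm_V dl : bounded_measurable (fun w => truncated_norm (dl * past_norm w)).
Proof. exact: (bm_comp (bm_truncated_norm dl) measurable_past_norm). Qed.

Let bm_X dl n : bounded_measurable (fun w => truncated_norm (dl * X n w)).
Proof. exact: (bm_comp (bm_truncated_norm dl) (mX n)). Qed.

Let bm_mu dl : bounded_measurable (fun w => \int[mu w]_x truncated_norm (dl * x)).
Proof. exact: (bm_mixture mu (bm_truncated_norm dl)). Qed.

Let past_close dl s s' b w : 0 <= dl ->
  (forall j, (j <= k)%N -> `|s j - s' j| <= dl) ->
  `|trig b (linear_combination s w) - trig b (linear_combination s' w)| <=
  truncated_norm (dl * past_norm w).
Proof.
move=> dl0 ss'; apply: le_trans (trig_truncated_norm _ _ _) _.
apply: le_truncated_norm.
have V0 : 0 <= past_norm w by exact: sumr_ge0.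
rewrite [leRHS]ger0_norm ?mulr_ge0// /linear_combination -sumrB mulr_sumr.
apply: le_trans (ler_norm_sum _ _ _) _; apply: ler_sum => j _.
by rewrite -mulrBl normrM ler_wpM2r// ss'// ltnW.
Qed.

Let present_close dl r r' b' n w : `|r - r'| <= dl ->
  `|(trig b' (r * X n w) - \int[mu w]_x trig b' (r * x)) -
    (trig b' (r' * X n w) - \int[mu w]_x trig b' (r' * x))| <=
  truncated_norm (dl * X n w) + \int[mu w]_x truncated_norm (dl * x).
Proof.
move=> rr'; have dl0 : 0 <= dl by exact: le_trans (normr_ge0 _) rr'.
have close x : `|trig b' (r * x) - trig b' (r' * x)| <= truncated_norm (dl * x).
  apply: le_trans (trig_truncated_norm _ _ _) _; apply: le_truncated_norm.
  by rewrite -mulrBl !normrM ler_wpM2r// (ger0_norm dl0).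
have -> : forall p q p' q' : R, (p - q) - (p' - q') = (p - p') - (q - q').
  by move=> p q p' q'; ring.
apply: le_trans (ler_normB _ _) _; apply: lerD => //.
rewrite -bm_RintegralB; [|exact: bm_trig..].
apply: bm_norm_Rintegral => //; last exact: bm_truncated_norm.
by apply: bmB; exact: bm_trig.
Qed.

Let mixing_defect_modulus dl n s s' b b' : 0 <= dl ->
  (forall j, (j <= k)%N -> `|s j - s' j| <= dl) ->
  `|mixing_defect n s b b' - mixing_defect n s' b b'| <= defect_modulus dl n.
Proof.
move=> dl0 ss'; rewrite /mixing_defect -bm_RintegralB; try exact: bm_integrand.
have b2V := bmM (bm_cst 2) (bm_V dl).
have bR := bmD (bmD b2V (bm_X dl n)) (bm_mu dl).
rewrite /defect_modulus -bm_RintegralZ// -bm_RintegralD// -bm_RintegralD//; last first.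
  exact: bmD.
apply: bm_norm_Rintegral => // [|w]; first exact: bmB.
have := past_close b w dl0 ss'; have := present_close b' n w (ss' k (leqnn k)).
set u := trig b (_ s w); set u' := trig b (_ s' w).
set v := (X in `|X - _|); set v' := (X in `|_ - X|) => hv hu.
have v2 : `|v| <= 2.
  rewrite (le_trans (ler_normB _ _))// lerD ?trig_le1//.
  apply: bm_norm_Rintegral_cst => [|x]; [exact: bm_trig|exact: trig_le1].
have -> : eta w * u * v - eta w * u' * v' =
  eta w * ((u - u') * v + u' * (v - v')) by ring.
rewrite normrM (le_trans (ler_piMl _ (eta1 w)))// -[leRHS]addrA.
apply: le_trans (ler_normD _ _) _; apply: lerD.
  by rewrite normrM mulrC ler_pM.
by rewrite normrM (le_trans (ler_piMl _ (trig_le1 _ _))).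
Qed.

(** Tightness enters here: the mean of the truncated norm of dl X n tends to its
    mean under mu, which is small with dl. *)
Let small_modulus e : 0 < e -> exists2 dl, 0 < dl &
  \forall n \near \oo, defect_modulus dl n <= e.
Proof.
move=> e0; have e5 : 0 < e / 5 by rewrite divr_gt0.
have harm_to0 (x : R) : truncated_norm (m.+1%:R^-1 * x) @[m --> \oo] --> (0 : R).
  have h : m.+1%:R^-1 * x @[m --> \oo] --> (0 : R).
    by rewrite -[X in _ --> X](mul0r x); apply: cvgMl; exact: cvg_harmonic.
  have h' : `|m.+1%:R^-1 * x| @[m --> \oo] --> (0 : R).
    by rewrite -(@normr0 _ R); exact: cvg_norm.
  have sq : \forall m \near \oo, (fun=> 0) m <= truncated_norm (m.+1%:R^-1 * x) <=
      `|m.+1%:R^-1 * x|.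
    by apply: nearW => m; rewrite truncated_norm_ge0 /truncated_norm ge_min lexx orbT.
  by apply: (squeeze_cvgr sq) h'; exact: cvg_cst.
have bnd x : `|truncated_norm x| <= 2.
  by rewrite ger0_norm ?truncated_norm_ge0// truncated_norm_le2.
have cV : \int[P]_w truncated_norm (m.+1%:R^-1 * past_norm w) @[m --> \oo] --> (0 : R).
  rewrite -[X in _ --> X](@prob_Rintegral_cst _ _ R P).
  apply: (@bounded_cvg_Rintegral _ _ _ _ _ (fun=> 0) 2) => // m.
  by case: (bm_V m.+1%:R^-1).
have cmu : \int[P]_w \int[mu w]_x truncated_norm (m.+1%:R^-1 * x) @[m --> \oo] --> (0 : R).
  rewrite -[X in _ --> X](@prob_Rintegral_cst _ _ R P).
  apply: (@bounded_cvg_Rintegral _ _ _ _ _ (fun=> 0) 2).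
  - by move=> m; case: (bm_mu m.+1%:R^-1).
  - move=> m w; apply: bm_norm_Rintegral_cst => //; exact: bm_truncated_norm.
  - move=> w; rewrite -[X in _ --> X](@prob_Rintegral_cst _ _ R (mu w)).
    apply: (@bounded_cvg_Rintegral _ _ _ _ _ (fun=> 0) 2) => // m.
    by case: (bm_truncated_norm (m.+1%:R^-1 : R)).
have [dl dl0 [hV hmu5]] : exists2 dl : R, 0 < dl &
    \int[P]_w truncated_norm (dl * past_norm w) <= e / 5 /\
    \int[P]_w \int[mu w]_x truncated_norm (dl * x) <= e / 5.
  move/cvgrPdist_le : cV => /(_ _ e5) cV; move/cvgrPdist_le : cmu => /(_ _ e5) cmu.
  near \oo => m; exists m.+1%:R^-1; first by rewrite invr_gt0.
  have : `|0 - \int[P]_w truncated_norm (m.+1%:R^-1 * past_norm w)| <= e / 5 by near: m.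
  have : `|0 - \int[P]_w \int[mu w]_x truncated_norm (m.+1%:R^-1 * x)| <= e / 5 by near: m.
  rewrite !sub0r !normrN => h1 h2.
  by split; apply: le_trans (ler_norm _) _.
exists dl => //.
have lip x y : `|truncated_norm (dl * x) - truncated_norm (dl * y)| <= `|dl| * `|x - y|.
  by rewrite -normrM mulrBr; exact: truncated_norm_lipschitz.
have := weak_cvg_Lipschitz hmu (bm_cst 1) (bm_truncated_norm dl) lip.
move/cvgrPdist_le => /(_ _ e5).
rewrite (_ : \int[P]_w (1 * _) = \int[P]_w \int[mu w]_x truncated_norm (dl * x)); last first.
  by apply: eq_Rintegral => w _; rewrite mul1r.
apply: filterS => n.
rewrite (_ : \int[P]_w (1 * _) = \int[P]_w truncated_norm (dl * X n w)); last first.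
  by apply: eq_Rintegral => w _; rewrite mul1r.
move/ler_normlP => [h _]; rewrite /defect_modulus; lra.
Unshelve. all: by end_near. Qed.

(** For fixed coefficients the defect tends to 0. It is equicontinuous in the
    coefficients, because the laws of the X n are tight, and the coefficients
    range over a compact box, so the convergence is uniform. *)
Lemma uniform_mixing (e : R) : 0 < e ->
  \forall n \near \oo, forall s : nat -> R,
    (forall j, (j <= k)%N -> `|s j| <= 1) ->
    forall b b', `|mixing_defect n s b b'| <= e.
Proof.
move=> e0; have e2 : 0 < e / 2 by rewrite divr_gt0.
pose ext (v : 'rV[R]_k.+1) (j : nat) := v ord0 (inord j).
pose box : set 'rV[R]_k.+1 := [set v | forall i, `[-1, 1]%classic (v ord0 i)].
have : compact box.
  exact: (@rV_compact R k.+1 (fun=> `[-1, 1]%classic) (fun=> @segment_compact R (-1) 1)).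
move/compact_near_coveringP => /(_ nat \oo
  (fun n v => forall b b', `|mixing_defect n (ext v) b b'| <= e) _) cov.
have {}cov : \forall n \near \oo, box `<=`
    (fun v => forall b b', `|mixing_defect n (ext v) b b'| <= e).
  apply: cov => v _.
  have [dl dl0 hdl] := small_modulus e2.
  have : \forall n \near \oo, forall p : bool * bool,
      `|mixing_defect n (ext v) p.1 p.2| <= e / 2.
    apply: filter_forall => -[b b'].
    have /cvgrPdist_le /(_ _ e2) := mixing_defect_cvg (ext v) b b'.
    by apply: filterS => n; rewrite sub0r normrN.
  move=> hv; exists (ball v dl, [set n | defect_modulus dl n <= e / 2 /\
      forall p : bool * bool, `|mixing_defect n (ext v) p.1 p.2| <= e / 2]).
    split; first by apply/nbhs_ballP; exists dl.
    exact: filterI.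
  move=> [v' n] /= [vv' [hn hp]] b b'.
  have close j : (j <= k)%N -> `|ext v' j - ext v j| <= dl.
    move=> _; rewrite /ext distrC; apply/ltW.
    by case: vv' => _ vv'; exact: (vv' ord0 (inord j)).
  have h1 := mixing_defect_modulus n b b' (ltW dl0) close.
  have h2 := hp (b, b').
  have -> : mixing_defect n (ext v') b b' =
    (mixing_defect n (ext v') b b' - mixing_defect n (ext v) b b') +
    mixing_defect n (ext v) b b' by rewrite subrK.
  by apply: le_trans (ler_normD _ _) _; rewrite /= in h2; lra.
apply: filterS cov => n cov s s1 b b'.
have ext_s j : (j <= k)%N -> ext (\row_i s i) j = s j.
  by move=> jk; rewrite /ext mxE inordK.
have -> : mixing_defect n s b b' = mixing_defect n (ext (\row_i s i)) b b'.
  rewrite /mixing_defect ext_s//.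
  have -> // : linear_combination s = linear_combination (ext (\row_i s i)).
  by apply/funext => w; apply: eq_bigr => j _; rewrite ext_s// ltnW.
apply: cov => i /=; rewrite mxE in_itv/= -ler_norml.
by apply: s1; rewrite -ltnS.
Qed.

End uniform_weak_convergence.

(** * Expansions of the random characteristic function *)

Section small_frequencies.
Variables (R : realType) (alpha c : R).
Hypothesis alpha0 : 0 < alpha.

Lemma continuous_mean_trig (nu : probability R R) b :
  continuous (fun t : R => \int[nu]_x trig b (t * x)).
Proof.
move=> t; have tI : t \in `]t - 1, t + 1[%classic.
  by rewrite inE/= in_itv/=; apply/andP; split; lra.
have := @continuity_under_integral R _ R nu (fun t x => trig b (t * x)) setT
  measurableT (t - 1) (t + 1) _ _ (cst 1) _ _ t tI.
apply.
- by move=> x _; exact: (bm_integrable nu (bm_trig b x)).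
- apply: aeW => x _ u _.
  apply: (@continuous_comp _ _ _ (fun t : R => t * x) (trig b)).
    exact: cvgMl.
  exact: continuous_trig.
- exact: (bm_integrable nu (bm_cst 1)).
- by move=> x _; apply: aeW => y _; exact: trig_le1.
Qed.

Lemma continuous_norm_powR (t : R) : t != 0 ->
  {for t, continuous (fun s : R => `|s| `^ alpha)}.
Proof.
move=> t0; have h : 0 < `|t| by rewrite normr_gt0.
apply: (@continuous_comp _ _ _ (fun s : R => `|s|) (fun s : R => s `^ alpha)).
  exact: norm_continuous.
apply: differentiable_continuous; apply/derivable1_diffP.
by case: (is_derive1_powR alpha h).
Qed.

Definition class_S_expansion (b : bool) (t : R) : R :=
  if b then 0 else 1 - c * `|t| `^ alpha.

Definition expansion_error (nu : probability R R) b t : R :=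
  `|\int[nu]_x trig b (t * x) - class_S_expansion b t|.

Lemma expansion_error0 nu b : expansion_error nu b 0 = 0.
Proof.
rewrite /expansion_error /class_S_expansion.
under eq_Rintegral do rewrite mul0r.
rewrite prob_Rintegral_cst; case: b; first by rewrite /trig sin0 subrr normr0.
by rewrite /trig cos0 normr0 powR0 ?gt_eqF// mulr0 subr0 subrr normr0.
Qed.

Lemma class_S_expansion_error nu e : class_S alpha c nu -> 0 < e ->
  exists2 dl, 0 < dl &
    forall t, `|t| < dl -> forall b, expansion_error nu b t <= e * `|t| `^ alpha.
Proof.
move=> [_ cS] e0; move/cvgrPdist_le : cS => /(_ _ e0) [dl /= dl0 H].
exists dl => // t tdl b.
have [->|t0] := eqVneq t 0.
  by rewrite expansion_error0 mulr_ge0 ?powR_ge0// ltW.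
have p0 : 0 < `|t| `^ alpha by rewrite powR_gt0// normr_gt0.
have := H t; rewrite /= sub0r normrN => /(_ tdl t0).
rewrite sub0r normrN /charfun; set u := \int[nu]_x cos (t * x); set v := \int[nu]_x sin (t * x).
rewrite normrM normfV (gtr0_norm p0) ler_pdivrMr//.
apply: le_trans; rewrite ger0_norm ?sqrtr_ge0//=.
rewrite /expansion_error /class_S_expansion -sqrtr_sqr ler_sqrt; last first.
  by rewrite addr_ge0 ?sqr_ge0.
case: b; rewrite /trig -/u -/v !subr0; first by rewrite lerDr sqr_ge0.
by rewrite lerDl sqr_ge0.
Qed.

(** At a nonzero frequency both sides are continuous, so the rational
    frequencies decide. *)
Lemma expansion_error_rat nu e dl :
  (forall q : rat, `|ratr q : R| < dl -> forall b,
     expansion_error nu b (ratr q) <= e * `|ratr q| `^ alpha) ->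
  forall t, `|t| < dl -> forall b, expansion_error nu b t <= e * `|t| `^ alpha.
Proof.
move=> H t tdl b; have [->|t0] := eqVneq t 0.
  rewrite expansion_error0 normr0 powR0 ?mulr0// gt_eqF//.
rewrite leNgt; apply/negP => bad.
pose g (s : R) := expansion_error nu b s - e * `|s| `^ alpha.
have cg : {for t, continuous g}.
  have cp := continuous_norm_powR t0.
  apply: cvgB; last by apply: cvgMr.
  apply: cvg_norm; apply: cvgB; first exact: continuous_mean_trig.
  rewrite /class_S_expansion; case: (b); first exact: cvg_cst.
  by apply: cvgB; [exact: cvg_cst|exact: cvgMr].
have : \forall s \near t, 0 < g s /\ `|s| < dl.
  apply: filterI; first by apply: (cvgr_gt (g t) cg); rewrite subr_gt0.
  exact: (cvgr_lt `|t| (@norm_continuous _ _ t)).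
rewrite -nbhs_nearE => /nbhs_interior.
set U := interior _ => Ut.
have [||s [Us [q _ qs]]] := @dense_rat R U.
- by exists t; exact: nbhs_singleton.
- exact: open_interior.
have [g0 sdl] := interior_subset Us.
by move: g0; rewrite ltNge subr_le0 -qs H// qs.
Qed.

End small_frequencies.

Section good_events.
Context d (T : measurableType d) (R : realType) (P : probability T R).
Variables (mu : {RV P >-> pprobability R R}) (alpha c : R).
Hypothesis alpha0 : 0 < alpha.
Hypothesis hS : {ae P, forall w, class_S alpha c (mu w)}.

(** The argument of Egorov's theorem: the events on which the expansion holds
    for |t| < 1 / (j + 1) increase with j, and their union has probability 1.
    Rational frequencies make these events measurable. *)
Lemma uniform_expansion (e : R) : 0 < e -> exists (A : set T) (dl : R),
  [/\ measurable A, fine (P (~` A)) <= e, 0 < dl &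
    forall w, A w -> forall t, `|t| < dl -> forall b,
      expansion_error alpha c (mu w) b t <= e * `|t| `^ alpha].
Proof.
move=> e0.
pose S j (qb : rat * bool) : set T := if `|ratr qb.1 : R| < j.+1%:R^-1 then
  [set w | expansion_error alpha c (mu w) qb.2 (ratr qb.1) <=
    e * `|ratr qb.1| `^ alpha] else setT.
pose A j := \bigcap_qb S j qb.
have mA j : measurable (A j).
  rewrite -[A j]setCK setC_bigcap; apply: measurableC.
  apply: countable_bigcupT_measurable => [|[q b]]; first exact: countableP.
  apply: measurableC; rewrite /S/=; case: ifP => // _.
  have [mt _] := bm_mixture mu (bm_trig b (ratr q : R)).
  have : measurable_fun [set: T] (fun w => expansion_error alpha c (mu w) b (ratr q)).
    apply: (@measurableT_comp _ _ _ _ _ _ (fun x : R => `|x|)) => //.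
    by apply: measurable_funB; [exact: mt|exact: measurable_cst].
  move=> /measurable_fun_ler /(_ (@measurable_cst _ _ _ _ _ (e * `|ratr q| `^ alpha))).
  move=> /(_ measurableT [set true] I); rewrite setTI.
  by congr measurable; apply/seteqP; split => w /=.
have AP j w : A j w -> forall t, `|t| < j.+1%:R^-1 -> forall b,
      expansion_error alpha c (mu w) b t <= e * `|t| `^ alpha.
  move=> Ajw; apply: expansion_error_rat => // q qj b.
  by have := Ajw (q, b) I; rewrite /S/= qj.
have PA : \int[P]_w \1_(~` A j) w @[j --> \oo] --> \int[P]_w \1_(~` \bigcup_j A j) w.
  apply: (@bounded_cvg_Rintegral _ _ _ _ _ _ 1).
  - by move=> j; exact/measurable_indic/measurableC.
  - by move=> j w; rewrite indicE; case: (_ \in _); rewrite ?normr1 ?normr0.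
  move=> w; apply: cvg_near_cst.
  have [[j _ Ajw]|nA] := pselect ((\bigcup_j A j) w).
    exists j => // i /= ji; rewrite !indicE !memNset//; apply.
      by exists j.
    move=> [q b] _; have := Ajw (q, b) I; rewrite /S/=.
    case: ifPn => // h; case: ifPn => // h'.
    exfalso; move/negP : h; apply; apply: lt_le_trans h' _.
    by rewrite lef_pV2 ?posrE// ler_nat.
  apply: nearW => i; rewrite !indicE !mem_set// => Aiw.
  by apply: nA; exists i.
have mU : measurable (~` \bigcup_j A j).
  by apply: measurableC; exact: bigcup_measurable.
have U0 : \int[P]_w \1_(~` \bigcup_j A j) w = 0.
  rewrite prob_Rintegral_indic//.
  suff -> : P (~` \bigcup_j A j) = 0%E by [].
  apply/(negligibleP P mU); apply: negligibleS hS => w /= nU cS; apply: nU.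
  have [dl dl0 H] := class_S_expansion_error alpha0 cS e0.
  exists (Num.truncn dl^-1) => // -[q b] _; rewrite /S/=; case: ifPn => // qj.
  apply: H; apply: lt_le_trans qj _.
  rewrite -[leRHS]invrK lef_pV2 ?posrE ?invr_gt0//.
  exact/ltW/truncnS_gt.
rewrite U0 in PA; move/cvgrPdist_le : PA => /(_ _ e0) [j _ /(_ j (leqnn j))] /=.
rewrite sub0r normrN prob_Rintegral_indic; last exact: measurableC.
move=> h; exists (A j), j.+1%:R^-1; split => //; last exact: AP.
exact: le_trans (ler_norm _) h.
Qed.

End good_events.

(** * Selection of the subsequence *)

Section subsequence_selection.
Context d (T : measurableType d) (R : realType) (P : probability T R).
Variables (X : nat -> {RV P >-> R}) (mu : {RV P >-> pprobability R R}).
Hypothesis hmu : is_limit_random_measure X mu.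
Variable A : nat -> set T.
Hypothesis mA : forall i, measurable (A i).

Let mixes_after (h : seq nat) (m : nat) : Prop :=
  (forall x, x \in h -> (x < m)%N) /\
  forall i, (i <= size h)%N -> forall s : nat -> R,
    (forall j, (j <= size h)%N -> `|s j| <= 1) -> forall b b',
    `|mixing_defect X mu (\1_(A i)) (fun j => X (nth 0%N h j)) (size h) m s b b'|
      <= (2^-1) ^+ (size h).

Let exists_next h : exists m, mixes_after h m.
Proof.
have e0 : 0 < (2^-1 : R) ^+ (size h) by rewrite exprn_gt0.
have : \forall m \near \oo, forall i : 'I_(size h).+1, forall s : nat -> R,
    (forall j, (j <= size h)%N -> `|s j| <= 1) -> forall b b',
    `|mixing_defect X mu (\1_(A i)) (fun j => X (nth 0%N h j)) (size h) m s b b'|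
      <= (2^-1) ^+ (size h).
  apply: filter_forall => i; apply: uniform_mixing => //.
  - exact: bm_indic.
  - by move=> w; rewrite indicE; case: (_ \in _); rewrite ?normr1 ?normr0.
move=> H; near \oo => m; exists m; split; last first.
  move=> i ih; have Hm : forall i : 'I_(size h).+1, forall s : nat -> R,
    (forall j, (j <= size h)%N -> `|s j| <= 1) -> forall b b',
    `|mixing_defect X mu (\1_(A i)) (fun j => X (nth 0%N h j)) (size h) m s b b'|
      <= (2^-1) ^+ (size h) by near: m.
  have ih' : (i < (size h).+1)%N by rewrite ltnS.
  exact: (Hm (Ordinal ih')).
move=> x xh; apply: (@leq_ltn_trans (\max_(y <- h) y)).
  exact: (@leq_bigmax_seq _ h xpredT id x xh isT).
by near: m; exact: nbhs_infty_gt.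
Unshelve. all: by end_near. Qed.

(** The indices are chosen one at a time, each as a function of the list of the
    indices chosen before. Uniformity in the coefficients is what makes the
    subsequence independent of the weights. *)
Lemma exists_mixing_subsequence : exists n : nat -> nat,
  {homo n : j k / (j < k)%N} /\
  forall k i, (i <= k)%N -> forall s : nat -> R,
    (forall j, (j <= k)%N -> `|s j| <= 1) -> forall b b',
    `|mixing_defect X mu (\1_(A i)) (fun j => X (n j)) k (n k) s b b'|
      <= (2^-1) ^+ k.
Proof.
have [next nextP] := choice exists_next.
pose hist := fix hist k := if k is k'.+1 then rcons (hist k') (next (hist k')) else [::].
pose n k := next (hist k).
have histE k : hist k = mkseq n k.
  by elim: k => [//|k IH]; rewrite mkseqS /= {1}IH.
have size_hist k : size (hist k) = k by rewrite histE size_mkseq.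
exists n; split.
  move=> j k jk; have [+ _] := nextP (hist k); apply.
  by rewrite histE; apply/mapP; exists j; rewrite ?mem_iota.
move=> k i ik s s1 b b'; have [_] := nextP (hist k); rewrite size_hist.
move=> /(_ i ik s s1 b b'); congr (`| _ | <= _).
apply: eq_Rintegral => w _; congr (_ * trig _ _ * _).
by apply: eq_bigr => j _; rewrite histE nth_mkseq.
Qed.

End subsequence_selection.

(** * Convergence of the characteristic functions *)

Section characteristic_function_limit.

Lemma telescoped_product (R : realType) (u p r : nat -> R) (K N : nat) :
  (K <= N)%N -> (forall k, 0 <= p k <= 1) ->
  (forall k, (K <= k < N)%N -> `|u k.+1 - p k * u k| <= r k) ->
  `|u N - (\prod_(K <= k < N) p k) * u K| <= \sum_(K <= k < N) r k.
Proof.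
move=> KN p01; elim: N KN => [|N IH].
  by rewrite leqn0 => /eqP -> _; rewrite !big_geq// mul1r subrr normr0.
rewrite leq_eqVlt => /predU1P[->|KN] H.
  by rewrite !big_geq// mul1r subrr normr0.
rewrite ltnS in KN; rewrite !big_nat_recr//=.
have -> : u N.+1 - \prod_(K <= i < N) p i * p N * u K =
  p N * (u N - \prod_(K <= i < N) p i * u K) + (u N.+1 - p N * u N) by ring.
apply: le_trans (ler_normD _ _) _; apply: lerD; last first.
  by apply: H; rewrite KN ltnSn.
have /andP[p0 p1] := p01 N.
rewrite normrM (ger0_norm p0); apply: le_trans (ler_piMl _ p1) _ => //.
by apply: IH => // k /andP[Kk kN]; apply: H; rewrite Kk ltnW.
Qed.

Lemma expR_second_order (R : realType) (x : R) : 0 <= x ->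
  `|1 - x - expR (- x)| <= x ^+ 2.
Proof.
move=> x0; have h1 := expR_ge1Dx (- x); have h2 := expR_ge1Dx x.
have x1 : 0 < 1 + x by rewrite ltr_pwDl.
have h3 : expR (- x) <= 1 - x + x ^+ 2.
  rewrite expRN; apply: (@le_trans _ _ (1 + x)^-1).
    by rewrite lef_pV2 ?posrE ?expR_gt0.
  rewrite -div1r ler_pdivrMr//.
  have -> : (1 - x + x ^+ 2) * (1 + x) = 1 + x ^+ 3 by ring.
  by rewrite lerDl exprn_ge0.
by rewrite ler_norml; apply/andP; split; have := sqr_ge0 x; lra.
Qed.

Context d (T : measurableType d) (R : realType) (P : probability T R).
Variables (X : nat -> {RV P >-> R}) (mu : {RV P >-> pprobability R R}).
Variables (alpha c : R).
Hypothesis c0 : 0 <= c.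
Variables (A : set T) (e dl : R).
Hypothesis mA : measurable A.
Hypothesis e0 : 0 <= e.
Hypothesis A_expansion : forall w, A w -> forall t, `|t| < dl -> forall b,
  expansion_error alpha c (mu w) b t <= e * `|t| `^ alpha.
Variable n : nat -> nat.

(** The characteristic function of the k-th partial sum, restricted to the event
    A on which the expansion of the random law is uniform. *)
Definition localized_trig_mean (s : nat -> R) (b : bool) (k : nat) : R :=
  \int[P]_w (\1_A w * trig b (\sum_(j < k) s j * X (n j) w)).

Let mZ j : measurable_fun [set: T] (X (n j)).
Proof. exact: measurable_funPT. Qed.

Let Z j : T -> R := X (n j).
Let D k s b b' := mixing_defect X mu (\1_A) Z k (n k) s b b'.
Let psi (t : R) : R := expR (- (c * `|t| `^ alpha)).

Let bm_past s k b : bounded_measurable (fun w => trig b (linear_combination Z k s w)).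
Proof.
have := bm_comp (bm_trig b 1) (measurable_linear_combination k mZ s).
by congr bounded_measurable; apply/funext => w; rewrite mul1r.
Qed.

(** One factor is split off with the addition formulas; the factor is replaced by
    its conditional mean at the cost of two mixing defects, and the conditional
    mean by psi at the cost of the expansion errors. *)
Lemma localized_trig_mean_step s b k : `|s k| < dl ->
  `|localized_trig_mean s b k.+1 - psi (s k) * localized_trig_mean s b k| <=
  `|D k s b false| + `|D k s (~~ b) true| +
  (e * `|s k| `^ alpha + (c * `|s k| `^ alpha) ^+ 2 + e * `|s k| `^ alpha).
Proof.
move=> sk.
pose S := linear_combination Z k s.
pose M b' w := \int[mu w]_x trig b' (s k * x).
pose sg : R := if b then 1 else -1.
have bA : bounded_measurable (\1_A : T -> R) by exact: bm_indic.
have bM b' : bounded_measurable (M b') by exact: (bm_mixture mu (bm_trig b' (s k))).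
have bY b' : bounded_measurable (fun w => trig b' (s k * Z k w)).
  exact: (bm_comp (bm_trig b' (s k)) (mZ k)).
have bAS b' : bounded_measurable (fun w => \1_A w * trig b' (S w)).
  exact: bmM bA (bm_past s k b').
have bD b1 b2 : bounded_measurable (fun w => \1_A w * trig b1 (S w) *
    (trig b2 (s k * Z k w) - M b2 w)).
  exact: bmM (bAS b1) (bmB (bY b2) (bM b2)).
pose err w := \1_A w * trig b (S w) * (M false w - psi (s k)) +
  sg * (\1_A w * trig (~~ b) (S w) * M true w).
have berr : bounded_measurable err.
  apply: bmD; first exact: bmM (bAS b) (bmB (bM false) (bm_cst _)).
  exact: bmM (bm_cst sg) (bmM (bAS (~~ b)) (bM true)).
have SE w : \sum_(j < k.+1) s j * X (n j) w = S w + s k * Z k w.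
  by rewrite big_ord_recr.
have -> : localized_trig_mean s b k.+1 - psi (s k) * localized_trig_mean s b k =
    (D k s b false + sg * D k s (~~ b) true) + \int[P]_w err w.
  rewrite /localized_trig_mean /D /mixing_defect -/(S) -bm_RintegralZ//.
  rewrite -(bm_RintegralZ P sg)//.
  have b1 : bounded_measurable (fun w => \1_A w * trig b (\sum_(j < k.+1) s j * X (n j) w)).
    by apply: bmM => //; exact: (bm_past s k.+1 b).
  rewrite -bm_RintegralB//; last exact: bmM (bm_cst _) (bAS b).
  rewrite -bm_RintegralD//; last exact: bmM (bm_cst sg) (bD _ _).
  rewrite -bm_RintegralD//; last first.
    exact: bmD (bD _ _) (bmM (bm_cst sg) (bD _ _)).
  apply: eq_Rintegral => w _; rewrite SE /err /M -/(S w).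
  have -> : trig b (S w + s k * Z k w) =
    trig b (S w) * trig false (s k * Z k w) +
    sg * (trig (~~ b) (S w) * trig true (s k * Z k w)).
    by rewrite /sg /trig; case: (b); rewrite /= ?sinD ?cosD ?mul1r// mulN1r.
  by rewrite -/(Z k w); ring.
apply: le_trans (ler_normD _ _) _; apply: lerD.
  apply: le_trans (ler_normD _ _) _; rewrite normrM.
  have -> : `|sg| = 1 by rewrite /sg; case: (b); rewrite ?normrN normr1.
  by rewrite mul1r.
apply: bm_norm_Rintegral_cst => // w.
have sa0 : 0 <= `|s k| `^ alpha by exact: powR_ge0.
have [Aw|nAw] := pselect (A w); last first.
  rewrite /err indicE memNset//= !mul0r mulr0 addr0 normr0.
  by rewrite !addr_ge0 ?mulr_ge0 ?sqr_ge0.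
have h1 := A_expansion Aw sk false; have h2 := A_expansion Aw sk true.
rewrite /expansion_error /class_S_expansion -/(M _ w) in h1 h2; rewrite subr0 in h2.
rewrite /err indicE mem_set//= !mul1r.
apply: le_trans (ler_normD _ _) _; apply: lerD.
  rewrite normrM; apply: le_trans (ler_piMl _ (trig_le1 _ _)) _ => //.
  have -> : M false w - psi (s k) = (M false w - (1 - c * `|s k| `^ alpha)) +
    (1 - c * `|s k| `^ alpha - psi (s k)) by ring.
  apply: le_trans (ler_normD _ _) _; apply: lerD => //.
  by apply: expR_second_order; exact: mulr_ge0.
rewrite normrM (_ : `|sg| = 1); last first.
  by rewrite /sg; case: (b); rewrite ?normrN normr1.
by rewrite mul1r normrM; apply: le_trans (ler_piMl _ (trig_le1 _ _)) _.
Qed.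

Variables (s : nat -> nat -> R) (v : R) (i : nat).
Hypothesis alpha0 : 0 < alpha.
Hypothesis dl0 : 0 < dl.
Hypothesis mixing : forall k, (i <= k)%N -> forall s : nat -> R,
  (forall j, (j <= k)%N -> `|s j| <= 1) -> forall b b', `|D k s b b'| <= (2^-1) ^+ k.
Hypothesis s_sum : \forall N \near \oo, \sum_(k < N) `|s N k| `^ alpha = v.
Hypothesis s_small : forall r, 0 < r ->
  \forall N \near \oo, forall k, (k < N)%N -> `|s N k| <= r.

Let s_powR_small r : 0 < r ->
  \forall N \near \oo, forall k, (k < N)%N -> `|s N k| `^ alpha <= r.
Proof.
move=> r0; have r1 : 0 < r `^ alpha^-1 by exact: powR_gt0.
apply: filterS (s_small r1) => N H k kN.
have -> : r = (r `^ alpha^-1) `^ alpha.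
  by rewrite -powRrM mulVf ?powRr1 ?gt_eqF// ltW.
by apply: ge0_ler_powR; rewrite ?nnegrE ?(ltW alpha0) ?(ltW r1)// H.
Qed.

(** The first K coefficients vanish in the limit, so the first K variables
    contribute nothing; the telescoping may start from any fixed K. *)
Let initial_segment_limit (K : nat) (b : bool) :
  expR (- (c * (v - \sum_(k < K) `|s N k| `^ alpha))) *
    localized_trig_mean (s N) b K @[N --> \oo] -->
  expR (- (c * v)) * (trig b 0 * fine (P A)).
Proof.
apply: cvgM.
  have cexp : {for v, continuous (fun x : R => expR (- (c * x)))}.
    apply: (@continuous_comp _ _ _ (fun x : R => - (c * x)) expR).
      by apply: cvgN; exact: cvgMr.
    exact: continuous_expR.
  suff sumK : v - \sum_(k < K) `|s N k| `^ alpha @[N --> \oo] --> v.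
    exact: (cvg_comp _ _ sumK cexp).
  rewrite -[X in _ --> X]subr0; apply: cvgB; first exact: cvg_cst.
  apply/cvgrPdist_le => q q0.
  have q1 : 0 < q / K.+1%:R by rewrite divr_gt0.
  near=> N; rewrite sub0r normrN ger0_norm; last first.
    by apply: sumr_ge0 => k _; exact: powR_ge0.
  have H : forall k, (k < N)%N -> `|s N k| `^ alpha <= q / K.+1%:R.
    by near: N; exact: s_powR_small.
  have KN : (K <= N)%N by near: N; exact: nbhs_infty_ge.
  apply: (@le_trans _ _ (\sum_(k < K) q / K.+1%:R)).
    by apply: ler_sum => k _; apply: H; exact: leq_trans (ltn_ord k) KN.
  rewrite sumr_const card_ord -[_ *+ K]mulr_natr -mulrA ger_pMr//.
  by rewrite mulrC ler_pdivrMr// mul1r ler_nat.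
have -> : trig b 0 * fine (P A) = \int[P]_w (\1_A w * trig b 0).
  rewrite -prob_Rintegral_indic// -bm_RintegralZ; last exact: bm_indic.
  by apply: eq_Rintegral => w _; rewrite mulrC.
apply: (@bounded_cvg_Rintegral _ _ _ _ _ _ 1).
- move=> N; have bA := @bm_indic _ T R A mA.
  by case: (bmM bA (bm_past (s N) K b)).
- move=> N w; rewrite normrM -[leRHS]mulr1 ler_pM ?trig_le1//.
  by rewrite indicE; case: (_ \in _); rewrite ?normr1 ?normr0.
move=> w; apply: cvgMr.
suff sumK : \sum_(j < K) s N j * X (n j) w @[N --> \oo] --> (0 : R).
  exact: (cvg_comp _ _ sumK (@continuous_trig _ b 0)).
apply/cvgrPdist_le => q q0; pose V := \sum_(j < K) `|X (n j) w|.
have V0 : 0 <= V by exact: sumr_ge0.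
have q1 : 0 < q / (V + 1) by rewrite divr_gt0// ltr_pwDr.
near=> N; rewrite sub0r normrN.
have H : forall k, (k < N)%N -> `|s N k| <= q / (V + 1).
  by near: N; exact: s_small.
have KN : (K <= N)%N by near: N; exact: nbhs_infty_ge.
apply: le_trans (ler_norm_sum _ _ _) _.
apply: (@le_trans _ _ (q / (V + 1) * V)).
  rewrite mulr_sumr; apply: ler_sum => j _; rewrite normrM ler_wpM2r//.
  by apply: H; exact: leq_trans (ltn_ord j) KN.
rewrite -mulrA ger_pMr// mulrC ler_pdivrMr ?ltr_pwDr//.
by rewrite mul1r lerDl.
Unshelve. all: by end_near. Qed.

Let sum_half (K N : nat) : (K <= N)%N ->
  \sum_(K <= k < N) (2^-1 : R) ^+ k <= 2 * (2^-1) ^+ K.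
Proof.
move=> KN; suff -> : \sum_(K <= k < N) (2^-1 : R) ^+ k =
    2 * (2^-1) ^+ K - 2 * (2^-1) ^+ N.
  by rewrite gerBl mulr_ge0// exprn_ge0.
elim: N KN => [|N IH]; first by rewrite leqn0 => /eqP ->; rewrite big_geq// subrr.
rewrite leq_eqVlt => /predU1P[->|KN]; first by rewrite big_geq// subrr.
by rewrite big_nat_recr//= IH// exprS; field.
Qed.

(** The error 2 e v comes from the expansion. The other errors vanish: the mixing
    defects are summable, so their sum from K on is small, and the quadratic
    terms are small because each coefficient is. *)
Lemma localized_trig_mean_limit b q : 0 < q -> \forall N \near \oo,
  `|localized_trig_mean (s N) b N - expR (- (c * v)) * (trig b 0 * fine (P A))| <=
  2 * e * v + q.
Proof.
move=> q0; have q4 : 0 < q / 4 by rewrite divr_gt0.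
have [K iK Kq] : exists2 K, (i <= K)%N & 4 * (2^-1 : R) ^+ K <= q / 4.
  have : 4 * (2^-1 : R) ^+ K @[K --> \oo] --> 4 * (0 : R).
    by apply: cvgMr; apply: cvg_expr; rewrite ger0_norm// invf_lt1// ltr1n.
  rewrite mulr0 => /cvgrPdist_le /(_ _ q4) H.
  near \oo => K; exists K; first by near: K; exact: nbhs_infty_ge.
  have : `|0 - 4 * (2^-1 : R) ^+ K| <= q / 4 by near: K.
  by rewrite sub0r normrN; apply: le_trans; exact: ler_norm.
have v0 : 0 <= v.
  near \oo => N; have <- : \sum_(k < N) `|s N k| `^ alpha = v by near: N.
  by apply: sumr_ge0 => k _; exact: powR_ge0.
pose h := q / (4 * (c ^+ 2 * v + 1)).
have cv : 0 < c ^+ 2 * v + 1 by rewrite ltr_pwDr// mulr_ge0// sqr_ge0.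
have h0 : 0 < h by rewrite divr_gt0// mulr_gt0.
have hq : c ^+ 2 * h * v <= q / 4.
  have -> : c ^+ 2 * h * v = q / 4 * (c ^+ 2 * v / (c ^+ 2 * v + 1)).
    by rewrite /h; field; rewrite gt_eqF.
  rewrite ger_pMr// ler_pdivrMr// mul1r lerDl//.
have /cvgrPdist_le /(_ _ q4) Hinit := @initial_segment_limit K b.
near=> N.
have KN : (K <= N)%N by near: N; exact: nbhs_infty_ge.
have sN1 : forall k, (k < N)%N -> `|s N k| <= 1 by near: N; exact: s_small.
have sNdl : forall k, (k < N)%N -> `|s N k| <= dl / 2.
  by near: N; apply: s_small; rewrite divr_gt0.
have sNh : forall k, (k < N)%N -> `|s N k| `^ alpha <= h.
  by near: N; exact: s_powR_small.
have sNv : \sum_(k < N) `|s N k| `^ alpha = v by near: N.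
have sumK : \sum_(K <= k < N) `|s N k| `^ alpha =
    v - \sum_(k < K) `|s N k| `^ alpha.
  pose F k := `|s N k| `^ alpha; rewrite -sNv -(big_mkord xpredT F).
  by rewrite (big_cat_nat (leq0n K) KN)/= big_mkord /F [RHS]addrC addKr.
have sumK_le : \sum_(K <= k < N) `|s N k| `^ alpha <= v.
  by rewrite sumK gerBl; apply: sumr_ge0 => k _; exact: powR_ge0.
pose r k := 2 * (2^-1 : R) ^+ k + (2 * e + c ^+ 2 * h) * `|s N k| `^ alpha.
have tele := @telescoped_product R (localized_trig_mean (s N) b)
  (fun k => psi (s N k)) r K N KN.
have {tele} : `|localized_trig_mean (s N) b N - (\prod_(K <= k < N) psi (s N k)) *
    localized_trig_mean (s N) b K| <= \sum_(K <= k < N) r k.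
  apply: tele => [k|k /andP[Kk kN]].
    rewrite expR_ge0/= -expR0 ler_expR oppr_le0.
    by rewrite mulr_ge0// powR_ge0.
  have skdl : `|s N k| < dl.
    apply: le_lt_trans (sNdl k kN) _.
    by rewrite ltr_pdivrMr// ltr_pMr// ltr1n.
  apply: le_trans (localized_trig_mean_step b skdl) _.
  have ik : (i <= k)%N by exact: leq_trans iK Kk.
  have s1 j : (j <= k)%N -> `|s N j| <= 1.
    by move=> jk; apply: sN1; exact: leq_ltn_trans jk kN.
  have d1 := mixing ik s1 b false; have d2 := mixing ik s1 (~~ b) true.
  have : (c * `|s N k| `^ alpha) ^+ 2 <= c ^+ 2 * h * `|s N k| `^ alpha.
    rewrite exprMn -[leRHS]mulrA ler_wpM2l ?sqr_ge0// expr2 ler_wpM2r ?powR_ge0//.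
    exact: sNh.
  by rewrite /r; lra.
have -> : \prod_(K <= k < N) psi (s N k) =
    expR (- (c * (v - \sum_(k < K) `|s N k| `^ alpha))).
  by rewrite -sumK mulr_sumr -sumrN expR_sum.
have rsum : \sum_(K <= k < N) r k <= q / 4 + (2 * e * v + q / 4).
  rewrite /r big_split/= -mulr_sumr -mulr_sumr; apply: lerD.
    apply: le_trans Kq; have := sum_half KN; lra.
  apply: (@le_trans _ _ ((2 * e + c ^+ 2 * h) * v)).
    have ch0 : 0 <= c ^+ 2 * h by apply: mulr_ge0; [exact: sqr_ge0|exact: ltW].
    by apply: ler_wpM2l => //; apply: addr_ge0 => //; exact: mulr_ge0.
  by rewrite mulrDl; lra.
have init : `|expR (- (c * v)) * (trig b 0 * fine (P A)) -
    expR (- (c * (v - \sum_(k < K) `|s N k| `^ alpha))) *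
    localized_trig_mean (s N) b K| <= q / 4 by near: N.
move: init; set x := expR _ * (_ * _); set y := expR _ * localized_trig_mean _ _ _.
move=> init tele.
have -> : localized_trig_mean (s N) b N - x =
  (localized_trig_mean (s N) b N - y) - (x - y) by ring.
by apply: le_trans (ler_normB _ _) _; lra.
Unshelve. all: by end_near. Qed.

End characteristic_function_limit.

Section normalized_coefficients.
Variables (R : realType) (alpha : R) (a : nat -> R).
Hypothesis alpha0 : 0 < alpha.
Hypothesis ha : asympt_negligible alpha a.

Let scaled (t : R) N k : R := t * a k / alpha_norm alpha a N.

Lemma sum_scaled_powR t :
  \forall N \near \oo, \sum_(k < N) `|scaled t N k| `^ alpha = `|t| `^ alpha.
Proof.
have [apos _] := ha; apply: filterS apos => N AN.
have SN : alpha_norm alpha a N `^ alpha = \sum_(k < N) `|a k| `^ alpha.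
  rewrite /alpha_norm -powRrM mulVf ?gt_eqF// powRr1//.
  by apply: sumr_ge0 => k _; exact: powR_ge0.
have term (k : 'I_N) : true -> `|scaled t N k| `^ alpha =
    `|t| `^ alpha / alpha_norm alpha a N `^ alpha * `|a k| `^ alpha.
  move=> _; rewrite mulrAC -powRM// -[in RHS]normrM.
  have -> : `|t * a k| = `|scaled t N k| * alpha_norm alpha a N.
    by rewrite /scaled [in RHS]normrM normfV (gtr0_norm AN) divfK// gt_eqF.
  by rewrite powRM ?(ltW AN)// mulfK// gt_eqF// powR_gt0.
rewrite (eq_bigr _ term) -mulr_sumr -SN divfK// gt_eqF// powR_gt0//.
Qed.

Lemma scaled_small t r : 0 < r ->
  \forall N \near \oo, forall k, (k < N)%N -> `|scaled t N k| <= r.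
Proof.
move=> r0; have t1 : 0 < `|t| + 1 by rewrite ltr_pwDr.
have [apos /cvgrPdist_le /(_ (r / (`|t| + 1)))] := ha.
move=> /(_ (divr_gt0 r0 t1)); apply: filterS2 apos => N AN.
rewrite sub0r normrN => h k kN.
have ak : `|a k| <= max_abs a N.
  exact: (le_bigmax 0 (fun k : 'I_N => `|a k|) (Ordinal kN)).
have {}h : max_abs a N / alpha_norm alpha a N <= r / (`|t| + 1).
  exact: le_trans (ler_norm _) h.
rewrite /scaled !normrM normfV (gtr0_norm AN) -mulrA.
apply: (@le_trans _ _ (`|t| * (r / (`|t| + 1)))).
  rewrite ler_wpM2l//; apply: le_trans h.
  by rewrite ler_wpM2r// invr_ge0 ltW.
rewrite mulrCA ger_pMr// ler_pdivrMr// mul1r lerDl//.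
Qed.

End normalized_coefficients.

Section trig_mean_limit.
Context d (T : measurableType d) (R : realType) (P : probability T R).
Variables (X : nat -> {RV P >-> R}) (mu : {RV P >-> pprobability R R}).
Variables (alpha c : R).
Hypothesis c0 : 0 <= c.
Hypothesis alpha0 : 0 < alpha.
Variables (A : nat -> set T) (dl : nat -> R).
Hypothesis mA : forall i, measurable (A i).
Hypothesis PA : forall i, fine (P (~` A i)) <= i.+1%:R^-1.
Hypothesis dl0 : forall i, 0 < dl i.
Hypothesis A_expansion : forall i w, A i w -> forall t, `|t| < dl i -> forall b,
  expansion_error alpha c (mu w) b t <= i.+1%:R^-1 * `|t| `^ alpha.
Variable n : nat -> nat.
Hypothesis mixing : forall k i, (i <= k)%N -> forall s : nat -> R,
    (forall j, (j <= k)%N -> `|s j| <= 1) -> forall b b',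
    `|mixing_defect X mu (\1_(A i)) (fun j => X (n j)) k (n k) s b b'|
      <= (2^-1) ^+ k.

Let mX j : measurable_fun [set: T] (X (n j)).
Proof. exact: measurable_funPT. Qed.

(** The event A i has probability at least 1 - 1 / (i + 1), so the localization
    costs little when i is fixed large enough, before N tends to infinity. *)
Lemma trig_mean_limit (s : nat -> nat -> R) (v : R) (b : bool) :
  (\forall N \near \oo, \sum_(k < N) `|s N k| `^ alpha = v) ->
  (forall r, 0 < r -> \forall N \near \oo, forall k, (k < N)%N -> `|s N k| <= r) ->
  \int[P]_w trig b (\sum_(k < N) s N k * X (n k) w) @[N --> \oo] -->
  trig b 0 * expR (- (c * v)).
Proof.
move=> s_sum s_small; apply/cvgrPdist_le => q q0.
have v0 : 0 <= v.
  near \oo => N; have <- : \sum_(k < N) `|s N k| `^ alpha = v by near: N.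
  by apply: sumr_ge0 => k _; exact: powR_ge0.
have v2 : 0 < 2 * v + 2 by rewrite ltr_pwDr// mulr_ge0.
pose i := Num.truncn (2 * (2 * v + 2) / q).
pose e : R := i.+1%:R^-1.
have e0 : 0 < e by rewrite invr_gt0.
have eq2 : e * (2 * v + 2) <= q / 2.
  have hi : 2 * (2 * v + 2) <= i.+1%:R * q.
    by rewrite -ler_pdivrMr//; exact/ltW/truncnS_gt.
  by rewrite /e mulrC ler_pdivrMr//; lra.
have q2 : 0 < q / 2 by rewrite divr_gt0.
have := @localized_trig_mean_limit _ _ _ P X mu alpha c c0 (A i) e (dl i) (mA i)
  (ltW e0) (@A_expansion i) n s v i alpha0 (dl0 i)
  (fun k ik s s1 b b' => mixing ik s1 b b') s_sum s_small b (q / 2) q2.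
apply: filterS => N.
set u := localized_trig_mean _ _ _ _ _ _; set E := expR _ => hu.
have bt : bounded_measurable (fun w => trig b (\sum_(k < N) s N k * X (n k) w)).
  have := bm_comp (bm_trig b 1) (measurable_linear_combination N mX (s N)).
  by congr bounded_measurable; apply/funext => w; rewrite mul1r.
have bA : bounded_measurable (\1_(A i) : T -> R) by exact: bm_indic.
have bAC : bounded_measurable (\1_(~` A i) : T -> R) by exact/bm_indic/measurableC.
have h1 : `|\int[P]_w trig b (\sum_(k < N) s N k * X (n k) w) - u| <= e.
  rewrite /u /localized_trig_mean -bm_RintegralB//; last exact: bmM.
  apply: le_trans (PA i); rewrite -prob_Rintegral_indic; last exact: measurableC.
  apply: bm_norm_Rintegral => // [|w]; first by apply: bmB => //; exact: bmM.
  rewrite !indicE in_setC; case: (w \in A i) => /=.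
    by rewrite mul1r subrr normr0.
  by rewrite mul0r subr0 trig_le1.
have PAE : fine (P (A i)) = 1 - fine (P (~` A i)).
  rewrite probability_setC// fineB ?fin_num_measure//= subKr//.
have h2 : `|trig b 0 * E - E * (trig b 0 * fine (P (A i)))| <= e.
  rewrite PAE.
  have -> : trig b 0 * E - E * (trig b 0 * (1 - fine (P (~` A i)))) =
    trig b 0 * (E * fine (P (~` A i))) by ring.
  rewrite normrM; apply: le_trans (ler_piMl _ (trig_le1 _ _)) _ => //.
  rewrite ger0_norm; last by rewrite mulr_ge0 ?expR_ge0 ?fine_ge0.
  apply: le_trans (PA i); rewrite ler_piMl ?fine_ge0//.
  by rewrite /E -expR0 ler_expR oppr_le0 mulr_ge0.
move: hu h1 h2; set I := \int[P]_w _; set L := E * _ => hu h1 h2.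
have -> : trig b 0 * E - I = (trig b 0 * E - L) - (u - L) - (I - u) by ring.
apply: le_trans (ler_normB _ _) _; apply: le_trans (lerD (ler_normB _ _) h1) _.
by lra.
Unshelve. all: by end_near. Qed.

End trig_mean_limit.

(** * The limit theorem *)

Unset Implicit Arguments.

Theorem theorem1p2 (d : measure_display) (T : measurableType d) (R : realType)
    (P : probability T R) (alpha c : R)
    (halpha0 : 0 < alpha) (halpha2 : alpha < 2) (hc : 0 < c)
    (X : nat -> {RV P >-> R}) (hX : determining X)
    (mu : {RV P >-> pprobability R R}) (hmu : is_limit_random_measure X mu)
    (hS : {ae P, forall w, class_S alpha c (mu w)})
    (G : probability R R) (hG : stable_law alpha c G) :
  exists n : nat -> nat,
    {homo n : j k / (j < k)%N} /\
    forall a : nat -> R, asympt_negligible alpha a ->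
      cvg_in_distribution P
        (fun N w => (alpha_norm alpha a N)^-1 * \sum_(k < N) a k * X (n k) w) G.
Proof.
have e0 i : 0 < i.+1%:R^-1 :> R by rewrite invr_gt0.
have /choice[f fP] i : exists p : set T * R,
    [/\ measurable p.1, fine (P (~` p.1)) <= i.+1%:R^-1, 0 < p.2 &
    forall w, p.1 w -> forall t, `|t| < p.2 -> forall b,
      expansion_error alpha c (mu w) b t <= i.+1%:R^-1 * `|t| `^ alpha].
  by have [A [dl H]] := uniform_expansion halpha0 hS (e0 i); exists (A, dl).
have mA i : measurable (f i).1 by case: (fP i).
have PA i : fine (P (~` (f i).1)) <= i.+1%:R^-1 by case: (fP i).
have dl0 i : 0 < (f i).2 by case: (fP i).
have A_exp i w : (f i).1 w -> forall t, `|t| < (f i).2 -> forall b,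
    expansion_error alpha c (mu w) b t <= i.+1%:R^-1 * `|t| `^ alpha.
  by case: (fP i) => _ _ _; apply.
have [n [n_incr mixing]] := exists_mixing_subsequence hmu mA.
exists n; split=> // a ha.
have mX j : measurable_fun [set: T] (X (n j)) by exact: measurable_funPT.
pose Y N w := (alpha_norm alpha a N)^-1 * \sum_(k < N) a k * X (n k) w.
have mY N : measurable_fun [set: T] (Y N).
  apply: measurable_funM; first exact: measurable_cst.
  exact: (measurable_linear_combination N mX a).
have G_trig b t : \int[G]_x trig b (t * x) =
    trig b 0 * expR (- (c * `|t| `^ alpha)).
  have := hG t; rewrite /charfun => -[hcos hsin].
  by case: b; rewrite /trig ?sin0 ?mul0r ?cos0 ?mul1r.
have Y_trig b t : \int[P]_w trig b (t * Y N w) @[N --> \oo] -->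
    \int[G]_x trig b (t * x).
  rewrite G_trig; have := @trig_mean_limit _ _ _ P X mu alpha c (ltW hc) halpha0
    (fun i => (f i).1) (fun i => (f i).2) mA PA dl0 A_exp n mixing
    (fun N k => t * a k / alpha_norm alpha a N) (`|t| `^ alpha) b
    (sum_scaled_powR halpha0 ha t) (scaled_small ha t).
  rewrite (_ : (fun N => \int[P]_w _) = (fun N => \int[P]_w trig b (t * Y N w)))//.
  apply/funext => N; apply: eq_Rintegral => w _; congr trig.
  rewrite /Y mulrA mulr_sumr; apply: eq_bigr => k _; ring.
apply: (@levy_continuity _ _ _ P Y G mY) => t theta.
have bY b N : bounded_measurable (fun w => trig b (t * Y N w)).
  exact: (bm_comp (bm_trig b t) (mY N)).
have phase (u : R) : cos (t * u + theta) =
    cos theta * trig false (t * u) - sin theta * trig true (t * u).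
  by rewrite cosD /trig; ring.
have -> : \int[G]_x cos (t * x + theta) =
    cos theta * \int[G]_x trig false (t * x) - sin theta * \int[G]_x trig true (t * x).
  rewrite -!bm_RintegralZ ?bm_trig//; try exact: bm_trig.
  rewrite -bm_RintegralB; [|exact: bmM (bm_cst _) (bm_trig _ _)..].
  by apply: eq_Rintegral => x _; rewrite phase.
have -> : (fun N => \int[P]_w cos (t * Y N w + theta)) =
    (fun N => cos theta * \int[P]_w trig false (t * Y N w) -
      sin theta * \int[P]_w trig true (t * Y N w)).
  apply/funext => N; rewrite -!bm_RintegralZ//.
  rewrite -bm_RintegralB; [|exact: bmM (bm_cst _) (bY _ _)..].
  by apply: eq_Rintegral => w _; rewrite phase.
by apply: cvgB; apply: cvgMr; exact: Y_trig.
Qed.
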